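(* Let $p>q>0$ be integers and let $a\in\mathbb{C}$ be a Misiurewicz point for the family $\mathbf{f}_c(z)=\sqrt[q]{z^p}+c$. Let $f_{j,c}$, $z_j(c)$, $\lambda(c)$ be the perturbed branches, the perturbed orbit and the multiplier, and $\varphi_c$ the Kœnigs linearizing map of $h_c$ at $z_\ell(c)$, for $c$ near $a$. If $V$ is an open set containing $z_\ell(c)$ with $\overline V\subset\operatorname{dom}(\varphi_c)$, let $\{B_j(c)\}_{j=0}^\infty$ be the sequence of compact sets inductively determined by $$B_\ell(c)=\varphi_c(\overline V\cap K_c),\qquad B_j(c)=f_{j,c}'(z_{j-1}(c))\cdot B_{j-1}(c)\quad (j\ge1).$$ For all $c$ in a neighborhood of $a$, the filled Julia set $K_c$ is asymptotically $\lambda(c)$-self-similar about each $z_j(c)$, $j\ge0$, with limit model $B_j(c)$.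
   Context: **The correspondence.** For $c\in\mathbb{C}$, $\mathbf{f}_c$ is the multivalued map with $w\in\mathbf{f}_c(z)$ iff $(w-c)^q=z^p$. A forward orbit of $z_0$ under $\mathbf{f}_c$ is a sequence $(z_j)_{j\ge0}$ with $z_{j+1}\in\mathbf{f}_c(z_j)$ for all $j$; it is bounded if it is contained in a compact subset of $\mathbb{C}$. The filled Julia set $K_c$ is the set of all $z\in\mathbb{C}$ having at least one bounded forward orbit under $\mathbf{f}_c$. A parameter $a\in\mathbb{C}$ is a Misiurewicz point if the critical point $0$ has a unique bounded forward orbit under $\mathbf{f}_a$ and this orbit is strictly pre-periodic (eventually periodic but not periodic). A univalent branch of $\mathbf{f}_c$ is an injective holomorphic map $f$ with $f(z)\in\mathbf{f}_c(z)$ for all $z$ in its domain. **Setting near a Misiurewicz point $a$.** The point $a$ has a unique bounded forward orbit $z_0=a,z_1,z_2,\dots$ under $\mathbf{f}_a$; it is pre-periodic and no $z_j$ equals $0$. Let $\ell$ be the smallest index such that $z_\ell$ lies on the cycle of this orbit (one has $\ell\ge1$) and $n$ the period, so $z_{j+n}=z_j$ for $j\ge\ell$. For $j\ge1$, $f_j$ is the univalent branch of $\mathbf{f}_a$ defined near $z_{j-1}$ with $f_j(z_{j-1})=z_j$, and $f_{j,c}=f_j+(c-a)$ is the corresponding perturbed branch of $\mathbf{f}_c$. Put $g_c=f_{\ell,c}\circ\cdots\circ f_{1,c}$ (near $a$) and $h_c=f_{\ell+n,c}\circ\cdots\circ f_{\ell+1,c}$ (near $z_\ell$). The cycle is known to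 be repelling: $|h_a'(z_\ell)|>1$. For $c$ near $a$, $z_\ell(c)$ denotes the fixed point of $h_c$ depending holomorphically on $c$ with $z_\ell(a)=z_\ell$; $\xi(c)$ is the unique point near $a$ with $g_c(\xi(c))=z_\ell(c)$ (holomorphic in $c$, $\xi(a)=a$); $z_0(c)=\xi(c)$ and $z_j(c)=f_{j,c}(z_{j-1}(c))$ for $j\ge1$, so that $z_{j+n}(c)=z_j(c)$ for $j\ge\ell$. The multiplier is $\lambda(c)=h_c'(z_\ell(c))$, with $|\lambda(c)|>1$ for $c$ near $a$. **Kœnigs map.** For $c$ near $a$, $\varphi_c$ is the univalent map defined on a small neighborhood $\operatorname{dom}(\varphi_c)$ of $z_\ell(c)$ with $\varphi_c(z_\ell(c))=0$, $\varphi_c'(z_\ell(c))=1$ and $\varphi_c(h_c(z))=\lambda(c)\varphi_c(z)$ for $z$ near $z_\ell(c)$. The recursion for $B_j(c)$ starts at $j=\ell$ and is used in both directions: for $j\le\ell$ it determines $B_{j-1}(c)=B_j(c)/f_{j,c}'(z_{j-1}(c))$. **Self-similarity.** For a closed nonempty $A\subset\mathbb{C}$ and $r>0$, let $A_r=(A\cap\overline{\mathbb{D}}_r)\cup\partial\mathbb{D}_r$, where $\mathbb{D}_r=\{|z|<r\}$, and let $T_{-x}A=\{z-x:z\in A\}$. For $\lambda\in\mathbb{C}$ with $|\lambda|>1$, $A$ is asymptotically $\lambda$-self-similar about $x\in A$ with limit model $B$ (a nonempty closed subset of $\mathbb{C}$) if, for some $r>0$, $(\lambda^kT_{-x}A)_r\to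 B_r$ as $k\to\infty$ in the Hausdorff distance. *)

(* Defs.v *)
From HB Require Import structures.
From mathcomp Require Import all_boot all_order all_algebra.
From mathcomp Require Import all_classical all_reals all_analysis.
From mathcomp Require Import complex.

Set Implicit Arguments.
Unset Strict Implicit.
Unset Printing Implicit Defensive.

Import Order.TTheory GRing.Theory Num.Theory.
Import numFieldNormedType.Exports.

Local Open Scope classical_set_scope.
Local Open Scope ring_scope.

(* The complex numbers over [R], presented as a [numClosedFieldType] so that
   MathComp-Analysis equips them with the topology and the norm of a numeric
   field, viewed as a normed space over itself. Consequently [derivable f z 1]
   is complex differentiability and [derive1 f z] is the complex derivative. *)
Definition Cplx (R : realType) : numClosedFieldType := R[i].

Section Correspondence.
Context {R : realType}.
Notation C := (Cplx R).
Implicit Types (p q l n : nat) (a c x lam : C) (A B D V : set C).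

(* [corr p q c z w] means w \in f_c(z), where f_c(z) = (z^p)^(1/q) + c. *)
Definition corr p q c (z w : C) : Prop := (w - c) ^+ q = z ^+ p.

Definition forward_orbit p q c (z0 : C) (o : nat -> C) : Prop :=
  o 0%N = z0 /\ forall j, corr p q c (o j) (o j.+1).

Definition bounded_orbit p q c (z0 : C) (o : nat -> C) : Prop :=
  forward_orbit p q c z0 o /\
  exists2 K : set C, compact K & forall j, K (o j).

Definition filled_julia p q c : set C :=
  [set z | exists o, bounded_orbit p q c z o].

Definition periodic_from l n (o : nat -> C) : Prop :=
  (0 < n)%N /\ forall j, (l <= j)%N -> o (j + n)%N = o j.

Definition strictly_preperiodic (o : nat -> C) : Prop :=
  (exists l n, periodic_from l n o) /\ ~ (exists n, periodic_from 0 n o).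

Definition misiurewicz p q a : Prop :=
  exists o : nat -> C,
    [/\ bounded_orbit p q a 0 o,
        forall o', bounded_orbit p q a 0 o' -> o' = o
      & strictly_preperiodic o].

(* From the index [l] on, the sequence [z] runs through a cycle of (least)
   period [n], and [z l] is the first term lying on this cycle. *)
Definition enters_cycle (z : nat -> C) l n : Prop :=
  [/\ periodic_from l n z,
      forall m, periodic_from l m z -> (n <= m)%N
    & forall i j, (i < l)%N -> (l <= j)%N -> z i <> z j].

Definition holomorphic_on D (f : C -> C) : Prop :=
  forall z, D z -> derivable f z 1.

Definition univalent_on D (f : C -> C) : Prop :=
  [/\ open D, holomorphic_on D f & {in D &, injective f}].

(* [f] restricts to a univalent branch of f_c near [x]. *)
Definition univalent_branch_at p q c x (f : C -> C) : Prop :=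
  exists D, [/\ D x, univalent_on D f & forall z, D z -> corr p q c z (f z)].

(* f_j is the branch of f_a at z_(j-1) with value z_j. Past the index l the
   base points z_(j-1) recur with period n; the last clause says that the same
   branch is used each time. Two branches at the same base point with the same
   value there agree near it, so this only fixes their domains; without it the
   domains could shrink to a point as j grows. *)
Definition orbit_branches p q a (z : nat -> C) l n (f : nat -> C -> C) : Prop :=
  (forall j, (0 < j)%N ->
     univalent_branch_at p q a (z j.-1) (f j) /\ f j (z j.-1) = z j) /\
  (forall j, (l < j)%N -> f (j + n)%N = f j).

(* f_(j,c); the functions [f j] being total, it is only meaningful for c near a
   and near z_(j-1), and so are the maps built from it below. *)
Definition perturbed a (f : nat -> C -> C) c (j : nat) : C -> C :=
  fun z => f j z + (c - a).

(* F (m + k) \o ... \o F (m + 1) *)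
Fixpoint compose (F : nat -> C -> C) (m k : nat) (z : C) : C :=
  if k is k'.+1 then F (m + k'.+1)%N (compose F m k' z) else z.

Definition gmap a (f : nat -> C -> C) l c : C -> C :=
  compose (perturbed a f c) 0 l.

Definition hmap a (f : nat -> C -> C) l n c : C -> C :=
  compose (perturbed a f c) l n.

Definition holomorphic_near a (u : C -> C) : Prop :=
  \forall c \near a, derivable u c 1.

Definition cycle_continuation a (f : nat -> C -> C) (z : nat -> C) l n
    (zl : C -> C) : Prop :=
  [/\ holomorphic_near a zl, zl a = z l
    & \forall c \near a, hmap a f l n c (zl c) = zl c].

Definition value_continuation a (f : nat -> C -> C) l (zl xi : C -> C) : Prop :=
  [/\ holomorphic_near a xi, xi a = a
    & \forall c \near a, gmap a f l c (xi c) = zl c].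

(* z_j(c) *)
Definition perturbed_orbit a (f : nat -> C -> C) (xi : C -> C) c (j : nat) : C :=
  compose (perturbed a f c) 0 j (xi c).

Definition multiplier a (f : nat -> C -> C) l n (zl : C -> C) c : C :=
  derive1 (hmap a f l n c) (zl c).

(* [phi], with domain [D], is a Koenigs map of [h] at its fixed point [x] of
   multiplier [lam]. *)
Definition koenigs_map (h : C -> C) x lam D (phi : C -> C) : Prop :=
  [/\ D x, univalent_on D phi, phi x = 0, derive1 phi x = 1
    & \forall w \near x, phi (h w) = lam * phi w].

Definition hausdorff_dist A B : \bar R :=
  let dist (x : C) (E : set C) :=
    ereal_inf [set (Normc.normc (x - y))%:E | y in E] in
  maxe (ereal_sup [set dist x B | x in A]) (ereal_sup [set dist y A | y in B]).

(* A_r *)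
Definition truncation (r : R) A : set C :=
  (A `&` [set z | Normc.normc z <= r]) `|` [set z | Normc.normc z = r].

Definition self_similar lam A x B : Prop :=
  [/\ 1 < `|lam|, closed A /\ A x, closed B /\ B !=set0
    & exists2 r : R, 0 < r &
        hausdorff_dist (truncation r [set lam ^+ k * (z - x) | z in A])
                       (truncation r B) @[k --> \oo] --> 0%E].

Definition limit_models a (f : nat -> C -> C) l (xi : C -> C) c
    (Bl : set C) (B : nat -> set C) : Prop :=
  B l = Bl /\
  forall j, (0 < j)%N ->
    B j = [set derive1 (perturbed a f c j) (perturbed_orbit a f xi c j.-1) * b
          | b in B j.-1].

End Correspondence.

(* Main.v *)
Require Import Defs.
From HB Require Import structures.
From mathcomp Require Import all_boot all_order all_algebra.
From mathcomp Require Import all_classical all_reals all_analysis.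
From mathcomp Require Import complex.
From mathcomp Require Import ring lra zify.
Import Order.TTheory GRing.Theory Num.Theory.
Import numFieldNormedType.Exports.
Local Open Scope classical_set_scope.
Local Open Scope ring_scope.

(* Since p > q, all bounded orbits of f_c stay in a common disc, and a
   compactness argument shows that {(c, z) : z \in K_c} is closed. The bounded
   orbit of a being unique, the other images a + zeta (z_j - a), zeta^q = 1, of
   z_(j-1) lie outside K_a; by closedness this persists for (c, z) near
   (a, z_(j-1)), so that z \in K_c if and only if f_(j,c)(z) \in K_c near
   z_(j-1)(c). Thus K_c is locally invariant under h_c near z_l(c), its image
   under phi_c is invariant under multiplication by lambda(c) near 0, and as
   phi_c is tangent to the identity K_c is self-similar about z_l(c). The branches
   f_(j,c) are conformal and match the germs of K_c at consecutive points of the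
   orbit, which carries the limit model along the orbit in both directions. *)

(** Holomorphy is used only through the derivative at each point, without integral formulas. Local
    surjectivity comes from minimising |f - w| on a disc, and continuity of f_j' from the algebraic
    formula that (f_j - a)^q = z^p imposes on it. The obstacle to one neighbourhood of a for all c
    is that j is unbounded: each index gives its own neighbourhood. Only the indices j < l + n are
    therefore handled by nearness to a; for a fixed c, all later ones repeat the same branch at the
    same point. This neighbourhood is chosen before phi_c and V. A second obstacle is that the
    truncation A_r behaves badly under multiplication and small displacements, since points near the
    circle may leave the disc. Limits are first stated with approximating points allowed outside the
    disc, a form that survives a change of base point at the price of a smaller radius; the circle
    is put back only at the end. *)

Set Implicit Arguments.
Unset Strict Implicit.
Unset Printing Implicit Defensive.

(** * Topology of the complex plane *)

Section ComplexPlane.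
Context {R : realType}.
Notation C := (Cplx R).

(* The norm of C is C-valued; nm is the same modulus as a real number. *)
Definition nm (x : C) : R := Normc.normc x.

Lemma normC_nm (x : C) : `|x| = (nm x)%:C%C.
Proof. by []. Qed.

Lemma nm_ge0 (x : C) : 0 <= nm x.
Proof. by have := normr_ge0 x; rewrite normC_nm ler0c. Qed.

Lemma nm_lt (x : C) (e : R) : (`|x| < e%:C%C) = (nm x < e).
Proof. by rewrite normC_nm ltcR. Qed.

Lemma nmD (x y : C) : nm (x + y) <= nm x + nm y.
Proof. exact: le_normcD. Qed.

Lemma nmM (x y : C) : nm (x * y) = nm x * nm y.
Proof. exact: Normc.normcM. Qed.

Lemma nm0 : nm 0 = 0.
Proof. exact: Normc.normc0. Qed.

Lemma nm1 : nm 1 = 1.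
Proof. exact: Normc.normc1. Qed.

Lemma nmN (x : C) : nm (- x) = nm x.
Proof. exact: normcN. Qed.

Lemma nmX (x : C) k : nm (x ^+ k) = nm x ^+ k.
Proof. by elim: k => [|k IH]; rewrite ?nm1// !exprS nmM IH. Qed.

Lemma nmV (x : C) : nm x^-1 = (nm x)^-1.
Proof. exact: Normc.normcV. Qed.

Lemma nm_eq0 (x : C) : (nm x == 0) = (x == 0).
Proof.
by apply/eqP/eqP => [/Normc.eq0_normc//|->]; rewrite nm0.
Qed.

Lemma nm_gt0 (x : C) : (0 < nm x) = (x != 0).
Proof. by rewrite lt0r nm_ge0 andbT nm_eq0. Qed.

Lemma nm_subC (x y : C) : nm (x - y) = nm (y - x).
Proof. by rewrite -nmN opprB. Qed.

Lemma nm_real (x : R) : nm x%:C%C = `|x|.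
Proof. by rewrite /nm /= expr0n /= addr0 sqrtr_sqr. Qed.

Lemma nmB (x y : C) : nm x - nm y <= nm (x - y).
Proof. by rewrite lerBlDr -{1}(subrK y x); exact: nmD. Qed.

Lemma nm_triangle (y x z : C) : nm (x - z) <= nm (x - y) + nm (y - z).
Proof. by rewrite -(subrKA y x); exact: nmD. Qed.

Lemma Cplx_real_gt0 (e : C) : 0 < e -> exists2 r : R, 0 < r & e = r%:C%C.
Proof.
move=> e0; exists (complex.Re e); first by move: e0; rewrite ltcE/= => /andP[].
by move: e0; case: e => a b; rewrite ltcE /= => /andP[/eqP -> _].
Qed.

Lemma nbhs_nm (x : C) (A : set C) :
  nbhs x A <-> exists2 e : R, 0 < e & forall y, nm (y - x) < e -> A y.
Proof.
split=> [/nbhs_ballP [e /= e0 eA]|[e e0 eA]].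
  have [r r0 er] := Cplx_real_gt0 e0; exists r => // y xy; apply: eA.
  by rewrite -ball_normE /= er nm_lt nm_subC.
apply/nbhs_ballP; exists (e%:C%C : C) => /=; first by rewrite ltcR.
move=> y; rewrite -ball_normE /= nm_lt => xy; apply: eA.
by rewrite nm_subC.
Qed.

Lemma nbhs_disc (x : C) (e : R) : 0 < e -> nbhs x [set y | nm (y - x) < e].
Proof. by move=> e0; apply/nbhs_nm; exists e. Qed.

Lemma cvg_nmP (T : Type) (F : set_system T) {FF : Filter F} (f : T -> C) (y : C) :
  f x @[x --> F] --> y <->
  (forall e : R, 0 < e -> \forall x \near F, nm (y - f x) < e).
Proof.
split=> [/(@cvgrPdist_lt _ _ _ F) h e e0|h].
  have e0' : 0 < (e%:C%C : C) by rewrite ltcR.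
  by apply: filterS (h _ e0') => x; rewrite nm_lt.
apply/(@cvgrPdist_lt _ _ _ F) => e e0; have [d d0 ->] := Cplx_real_gt0 e0.
by apply: filterS (h _ d0) => x; rewrite nm_lt.
Qed.

Lemma nbhs_nm_lt (x : C) (r : R) : nm x < r -> nbhs x [set y | nm y < r].
Proof.
move=> xr; apply/nbhs_nm; exists (r - nm x); first by rewrite subr_gt0.
move=> y xy /=; have := nmB y x; lra.
Qed.

Lemma nm_continuous : continuous (nm : C -> R).
Proof.
move=> x; apply/(@cvgrPdist_lt _ _ _ (nbhs x)) => e e0.
apply: filterS (nbhs_disc x e0) => y /= h.
rewrite ltr_norml; apply/andP; split.
  by have := nmB y x; lra.
by have := nmB x y; rewrite nm_subC; lra.
Qed.

(** The disc is a closed subset of the image of the square [-r, r]^2 under the continuous map (x, y)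
    -> x + iy. *)
Lemma disc_compact (r : R) : compact [set z : C | nm z <= r].
Proof.
pose g (u : R * R) : C := (u.1 +i* u.2)%C.
have gc : continuous g.
  move=> u; apply/cvg_nmP => d d0.
  have h1 : \forall v \near u, `|u.1 - v.1| < d / 2.
    have : (fst v) @[v --> u] --> u.1 by exact: cvg_fst.
    by move/cvgrPdist_lt; apply; lra.
  have h2 : \forall v \near u, `|u.2 - v.2| < d / 2.
    have : (snd v) @[v --> u] --> u.2 by exact: cvg_snd.
    by move/cvgrPdist_lt; apply; lra.
  near=> v.
  have -> : g u - g v = (u.1 - v.1)%:C%C + 'i%C * (u.2 - v.2)%:C%C.
    by apply/eqP; rewrite eq_complex /=; apply/andP; split; apply/eqP; ring.
  apply: (le_lt_trans (nmD _ _)); rewrite nmM !nm_real.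
  have -> : nm 'i%C = 1 by rewrite /nm /= expr0n expr1n add0r sqrtr1.
  have a1 : `|u.1 - v.1| < d / 2 by near: v.
  have a2 : `|u.2 - v.2| < d / 2 by near: v.
  lra.
have cI : compact (`[- r, r]%classic `*` `[- r, r]%classic : set (R * R)).
  by apply: compact_setX; exact: segment_compact.
have cB : compact (g @` (`[- r, r]%classic `*` `[- r, r]%classic)).
  exact: continuous_compact (continuous_subspaceT gc) cI.
apply: (subclosed_compact _ cB).
  apply: (@preimage_closed _ _ (nm : C -> R) [set x | x <= r]); last exact: closed_le.
  by move=> ? _; exact: nm_continuous.
move=> [x y] /= xyr; exists (x, y) => //=.
have hh : Num.sqrt (x ^+ 2 + y ^+ 2) <= r by [].
have r0 : 0 <= r by apply: le_trans hh; exact: sqrtr_ge0.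
by split; rewrite /= in_itv /= -ler_norml; apply: le_trans hh;
  rewrite -sqrtr_sqr ler_wsqrtr// ?lerDl ?lerDr sqr_ge0.
Unshelve. all: by end_near. Qed.

Lemma compact_nm_bounded (K : set C) : compact K ->
  exists M : R, forall x, K x -> nm x <= M.
Proof.
move=> cK.
have cE : compact (nm @` K : set R).
  apply: continuous_compact => //.
  by apply: continuous_subspaceT => x; exact: nm_continuous.
have [M [_ hM]] := compact_bounded cE.
exists (M + 1) => x Kx.
have /(_ (M + 1)) := hM; rewrite ltrDl ltr01 => /(_ isT (nm x)) h.
by apply: le_trans (ler_norm _) _; apply: h; exists x.
Qed.

Lemma compactP_nm (K : set C) (r : R) :
  closed K -> (forall z, K z -> nm z <= r) -> compact K.
Proof. by move=> cK Kr; apply: (subclosed_compact cK (@disc_compact r)). Qed.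

Lemma Cplx_hausdorff : hausdorff_space C.
Proof. exact: norm_hausdorff. Qed.

Lemma continuous_nmP (f : C -> C) (x : C) :
  {for x, continuous f} <->
  (forall e : R, 0 < e -> \forall y \near x, nm (f y - f x) < e).
Proof.
split=> [h e e0|h].
  by have /(@cvg_nmP _ (nbhs x))/(_ _ e0) := h; apply: filterS => y; rewrite nm_subC.
by apply/(@cvg_nmP _ (nbhs x)) => e e0; apply: filterS (h _ e0) => y; rewrite nm_subC.
Qed.

Lemma continuous_subr (f : C -> C) (w x : C) :
  {for x, continuous f} -> {for x, continuous (fun y => f y - w)}.
Proof.
move=> /continuous_nmP h; apply/continuous_nmP => e e0.
by apply: filterS (h _ e0) => y; rewrite opprB addrA subrK.
Qed.

Lemma disc_at_compact (x : C) (r : R) : compact [set y : C | nm (y - x) <= r].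
Proof.
apply: (@compactP_nm _ (r + nm x)); last first.
  by move=> y /= yr; have := nmD (y - x) x; rewrite subrK; lra.
apply: (@preimage_closed _ _ (fun y : C => y - x) [set y : C | nm y <= r]).
  by move=> y _; apply: continuous_subr; exact: cvg_id.
exact: (compact_closed Cplx_hausdorff (@disc_compact r)).
Qed.

End ComplexPlane.

(** * Complex derivatives *)

Section ComplexDerivative.
Context {R : realType}.
Notation C := (Cplx R).
Implicit Types (f g : C -> C) (x d : C).

Definition has_deriv f x d := is_derive (x : C) (1 : C) f d.

Lemma has_derivE f x d : has_deriv f x d -> derive1 f x = d.
Proof. by move=> h; rewrite derive1E; exact: derive_val. Qed.

Lemma derivable_has_deriv f x : derivable f x 1 -> has_deriv f x (derive1 f x).
Proof. by move=> h; rewrite derive1E; apply: DeriveDef. Qed.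

Lemma has_deriv_continuous f x d : has_deriv f x d -> {for x, continuous f}.
Proof. by case=> df _; exact/differentiable_continuous/derivable1_diffP. Qed.

(** Multiplying the error of the difference quotient by |y - x| makes the estimate trivial at y = x,
    so it holds on a full neighbourhood instead of a punctured one. *)
Lemma has_deriv_near f x d : has_deriv f x d <->
  forall e : R, 0 < e -> \forall y \near x,
    nm (f y - f x - d * (y - x)) <= e * nm (y - x).
Proof.
have key (h : C) : h != 0 -> nm (f (h + x) - f x - d * h) =
    nm h * nm (d - h^-1 *: ((f \o shift x) (h *: 1) - f x)).
  move=> h0; have -> : (f \o shift x) (h *: 1) = f (h + x) by rewrite /= [h%:A]mulr1.
  rewrite -nmM -nmN; congr nm.
  by rewrite mulrBr [h * (h^-1 *: _)](mulVKf h0) opprB mulrC.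
split=> [hf e e0|H].
  have dc : h^-1 *: ((f \o shift x) (h *: 1) - f x) @[h --> 0^'] --> d.
    by case: hf => hf1 <-; exact: hf1.
  have /(@cvg_nmP _ _ 0^')/(_ e e0) := dc.
  move/nbhs_nm => [r r0 hr]; apply/nbhs_nm; exists r => // y yx.
  have [->|yx0] := eqVneq y x; first by rewrite !subrr mulr0 subr0 nm0 mulr0.
  have h0 : y - x != 0 by rewrite subr_eq0.
  have := key _ h0; rewrite subrK => ->.
  rewrite mulrC ler_wpM2r ?nm_ge0//.
  by have := hr (y - x); rewrite subr0 => /(_ yx h0) /ltW.
have dc : h^-1 *: ((f \o shift x) (h *: 1) - f x) @[h --> 0^'] --> d.
  apply/(@cvg_nmP _ _ 0^') => e e0.
  have e20 : 0 < e / 2 by rewrite divr_gt0.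
  have /nbhs_nm[r r0 hr] := H _ e20.
  apply/nbhs_nm; exists r => // h hr0 h0.
  have h1 : 0 < nm h by rewrite nm_gt0.
  have := hr (h + x); rewrite addrK -[in nm h](subr0 h) => /(_ hr0).
  rewrite (key _ h0) subr0 mulrC ler_pM2r// => /le_lt_trans; apply.
  by rewrite ltr_pdivrMr// ltr_pMr// ltr1n.
apply: DeriveDef; first by apply/cvg_ex; exists d.
exact: cvg_lim dc.
Qed.

Lemma has_deriv_comp f g x d e : has_deriv f x d -> has_deriv g (f x) e ->
  has_deriv (fun y => g (f y)) x (e * d).
Proof.
move=> hf hg; have fc := has_deriv_continuous hf.
move/has_deriv_near in hf; move/has_deriv_near in hg.
apply/has_deriv_near => r r0.
pose A := nm d + 1; pose E := nm e + 1.
have A0 : 0 < A by rewrite ltr_pwDr// nm_ge0.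
have E0 : 0 < E by rewrite ltr_pwDr// nm_ge0.
have r1 : 0 < r / 2 / A by rewrite !divr_gt0.
(* The bound 1 yields |f y - f x| <= (|d| + 1) |y - x|; the bound [r / 2 / E] leaves half of the
   error [r] to the inner map, the other half going to [g]. *)
have r2 : 0 < Num.min 1 (r / 2 / E) by rewrite lt_min ltr01 !divr_gt0.
have h1 : \forall y \near x, nm (g (f y) - g (f x) - e * (f y - f x)) <= r / 2 / A * nm (f y - f x).
  exact: fc (hg _ r1).
apply: filterS2 h1 (hf _ r2) => y h1 h2.
set h := nm (y - x) in h2 *; have h0 : 0 <= h by exact: nm_ge0.
have h21 : nm (f y - f x - d * (y - x)) <= h.
  by apply: (le_trans h2); rewrite ler_piMl// ge_min lexx.
have h22 : nm e * nm (f y - f x - d * (y - x)) <= r / 2 * h.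
  apply: (@le_trans _ _ (E * (r / 2 / E * h))).
    apply: ler_pM; rewrite ?nm_ge0// ?lerDl//; apply: (le_trans h2).
    by rewrite ler_wpM2r// ge_min lexx orbT.
  by rewrite mulrA [E * _]mulrC divfK// gt_eqF.
have h3 : nm (f y - f x) <= A * h.
  have := nmD (f y - f x - d * (y - x)) (d * (y - x)); rewrite subrK nmM -/h.
  by rewrite /A mulrDl mul1r; lra.
have h4 : r / 2 / A * nm (f y - f x) <= r / 2 * h.
  apply: (le_trans (ler_wpM2l (ltW r1) h3)).
  by rewrite mulrA divfK// gt_eqF.
have -> : g (f y) - g (f x) - e * d * (y - x) =
    (g (f y) - g (f x) - e * (f y - f x)) + e * (f y - f x - d * (y - x)).
  by rewrite [e * (_ - d * _)]mulrBr addrA subrK mulrA.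
apply: (le_trans (nmD _ _)); rewrite nmM; lra.
Qed.

Lemma has_deriv_unique f x d e : has_deriv f x d -> has_deriv f x e -> d = e.
Proof. by move=> /has_derivE <- /has_derivE <-. Qed.

Lemma has_deriv_ext f g x d : (\forall y \near x, f y = g y) ->
  has_deriv f x d -> has_deriv g x d.
Proof.
move=> fg /has_deriv_near H; apply/has_deriv_near => e e0.
have fgx := nbhs_singleton fg.
by apply: filterS2 fg (H e e0) => y <-; rewrite -fgx.
Qed.

(** Openness at one point only: it supplies preimages close to [x] of the points close to [f x],
    where a local inverse would otherwise serve. *)
Definition open_at f x := forall U, nbhs x U -> nbhs (f x) (f @` U).

(* A point of a small disc where |f - w| is minimal is a zero of f - w: otherwise
   moving in the direction (w - f) / f' would decrease |f - w|. *)
Lemma has_deriv_open_at f x :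
  (\forall y \near x, exists2 d, d != 0 & has_deriv f y d) -> open_at f x.
Proof.
move=> H U /nbhs_nm[r1 r10 hU].
have [d d0 hd] := nbhs_singleton H.
have nd0 : 0 < nm d by rewrite nm_gt0.
have nd2 : 0 < nm d / 2 by rewrite divr_gt0.
have /has_deriv_near/(_ _ nd2)/nbhs_nm[r2 r20 h2] := hd.
have [r3 r30 h3] : exists2 r : R, 0 < r & forall y, nm (y - x) < r -> exists2 d, d != 0 & has_deriv f y d.
  by apply/nbhs_nm.
have m0 : 0 < Num.min r1 (Num.min r2 r3) by rewrite !lt_min r10 r20 r30.
pose r := Num.min r1 (Num.min r2 r3) / 2.
have r0 : 0 < r by rewrite divr_gt0.
have rr : r < Num.min r1 (Num.min r2 r3) by rewrite ltr_pdivrMr// ltr_pMr// ltr1n.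
move: rr; rewrite !lt_min => /and3P[rr1 rr2 rr3].
(* On the circle |y - x| = r the first-order estimate gives |f y - f x| >= |d| r / 2. So |f y - w|
   exceeds |f x - w| there once |w - f x| < |d| r / 4, and the minimum is interior. *)
apply/nbhs_nm; exists (nm d * r / 4); first by rewrite divr_gt0// mulr_gt0.
move=> w wx.
pose K := [set y | nm (y - x) <= r].
have cK : compact K by exact: disc_at_compact.
have fc y : K y -> {for y, continuous f}.
  move=> Ky; have [d' _ hd'] := h3 y (le_lt_trans Ky rr3).
  exact: has_deriv_continuous hd'.
have nc : {within K, continuous (fun y => nm (f y - w))}.
  apply: continuous_in_subspaceT => y; rewrite inE => /fc yc.
  apply: (@continuous_comp _ _ _ (fun y => f y - w) nm); last exact: nm_continuous.
  exact: continuous_subr.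
have Kx : K x by rewrite /K /= subrr nm0 ltW.
have [y Ky ymin] := compact_EVT_min (ex_intro _ x Kx) cK nc.
move: Ky; rewrite inE => Ky.
have ymin0 : nm (f y - w) <= nm (f x - w) by apply: ymin; rewrite inE.
have yr : nm (y - x) < r.
  rewrite lt_neqAle Ky andbT; apply/eqP => yr.
  have := h2 y; rewrite yr => /(_ rr2) h.
  have := nmB (d * (y - x)) (f y - f x); rewrite (nm_subC (d * _)) nmM yr.
  have := nm_triangle w (f y) (f x); have := mulr_gt0 nd0 r0.
  by rewrite (nm_subC (f x) w) in ymin0; lra.
exists y; first by apply: hU; lra.
apply/eqP; rewrite -subr_eq0; apply: contraT => fyw.
have [d' d'0 hd'] := h3 y (lt_trans yr rr3).
(* The Newton step from [y] towards a zero of f - w. With the error rate [e] below, moving by t v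
   brings m = |f y - w| down to at most (1 - t) m + t m / 2, against minimality. *)
pose v := (w - f y) / d'.
have fy0 : 0 < nm (f y - w) by rewrite nm_gt0.
have v0 : 0 < nm v by rewrite nm_gt0 /v mulf_neq0 ?invr_eq0 // subr_eq0 eq_sym -subr_eq0.
pose e := nm (f y - w) / (2 * nm v).
have e0 : 0 < e by rewrite divr_gt0// mulr_gt0.
have /has_deriv_near/(_ _ e0)/nbhs_nm[s s0 hs] := hd'.
pose t := Num.min 1 (Num.min s (r - nm (y - x)) / (2 * nm v)).
have m1 : 0 < Num.min s (r - nm (y - x)) by rewrite lt_min s0 subr_gt0.
have t0 : 0 < t by rewrite lt_min ltr01 divr_gt0// mulr_gt0.
have t1 : t <= 1 by rewrite ge_min lexx.
have tv : t * nm v < Num.min s (r - nm (y - x)).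
  apply: (@le_lt_trans _ _ (Num.min s (r - nm (y - x)) / 2)); last lra.
  have h : t <= Num.min s (r - nm (y - x)) / (2 * nm v) by rewrite ge_min lexx orbT.
  have := ler_wpM2r (ltW v0) h.
  by rewrite invfM mulrA divfK ?gt_eqF.
move: tv; rewrite lt_min => /andP[tvs tvr].
pose y' := y + t%:C%C * v.
have ny' : nm (y' - y) = t * nm v.
  by rewrite /y' addrAC subrr add0r nmM nm_real gtr0_norm.
have Ky' : K y'.
  by rewrite /K /=; have := nm_triangle y y' x; rewrite ny'; lra.
have := ymin y'; rewrite inE => /(_ Ky').
have := hs y'; rewrite ny' => /(_ tvs).
have -> : f y' - f y - d' * (y' - y) = (f y' - w) - (f y - w) * (1 - t)%:C%C.
  have -> : d' * (y' - y) = t%:C%C * (w - f y).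
    by rewrite /y' [y + _]addrC addrK mulrCA [d' * _]mulrC divfK.
  rewrite rmorphB rmorph1; ring.
have := nmB (f y' - w) ((f y - w) * (1 - t)%:C%C).
rewrite nmM nm_real ger0_norm; last by lra.
have -> : e * (t * nm v) = nm (f y - w) * t / 2.
  by rewrite /e; field; rewrite ?gt_eqF.
have := mulr_gt0 fy0 t0.
lra.
Qed.

Lemma open_at_comp f g x : open_at f x -> open_at g (f x) ->
  open_at (fun y => g (f y)) x.
Proof.
move=> hf hg U /hf/hg; apply: filterS => _ [_ [y Uy <-] <-].
by exists y.
Qed.

End ComplexDerivative.

(** * Compactness of the filled Julia sets *)

Section FilledJulia.
Context {R : realType}.
Notation C := (Cplx R).
Variables (p q : nat).
Hypotheses (q_gt0 : (0 < q)%N) (q_lt_p : (q < p)%N).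

Lemma roots_finite (k : nat) (u : C) : (0 < k)%N ->
  exists s : seq C, forall x, x ^+ k = u -> x \in s.
Proof.
move=> k0; have [s hs] := closed_field_poly_normal ('X^k - u%:P : {poly C}).
exists s => x xu; have : root ('X^k - u%:P) x.
  by rewrite /root hornerD hornerN hornerXn hornerC xu subrr.
have lc : lead_coef ('X^k - u%:P : {poly C}) = 1 by rewrite lead_coefXnsubC.
by rewrite hs lc scale1r root_prod_XsubC.
Qed.

(** If |z| >= 2^q then |z|^p >= |z|^(q+1) >= (2 |z|)^q, so every image w has |w - c| >= 2 |z|; if
    moreover |z| >= s + 1 >= |c| + 1, then |w| >= |z| + 1. *)
Definition escape_radius (s : R) : R := 2 ^+ q + s + 1.

Lemma corr_escape (s : R) (c z w : C) : nm c <= s -> escape_radius s <= nm z ->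
  corr p q c z w -> nm z + 1 <= nm w.
Proof.
rewrite /escape_radius => cs zr /(congr1 nm); rewrite !nmX => wz.
have s0 : 0 <= s by apply: le_trans cs; exact: nm_ge0.
have q2 : 1 <= 2 ^+ q :> R by apply: exprn_ege1; lra.
have z1 : 1 <= nm z by lra.
suff h : 2 * nm z <= nm (w - c) by have := nmD w (- c); rewrite nmN; lra.
rewrite -(@ler_pXn2r _ q)// ?nnegrE ?nm_ge0//; last by apply: mulr_ge0 => //; lra.
rewrite wz exprMn; apply: (@le_trans _ _ (nm z ^+ q.+1)).
  by rewrite exprS ler_wpM2r ?exprn_ge0 ?nm_ge0//; lra.
by apply: ler_weXn2l.
Qed.

(** A point beyond the radius gains at least 1 in modulus at every later step, which no compact set
    allows. *)
Lemma bounded_orbit_disc (s : R) (c z : C) o : nm c <= s ->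
  bounded_orbit p q c z o -> forall j, nm (o j) <= escape_radius s.
Proof.
move=> cs [[_ oc] [K cK Ko]] j; rewrite leNgt; apply/negP => oj.
have [M hM] := compact_nm_bounded cK.
have grow i : nm (o j) + i%:R <= nm (o (j + i)%N).
  elim: i => [|i IH]; first by rewrite addr0 addn0.
  rewrite addnS; apply: (@le_trans _ _ (nm (o (j + i)%N) + 1)).
    by rewrite -natr1; lra.
  apply: (corr_escape cs) (oc _).
  by apply: (le_trans (ltW oj)); apply: le_trans IH; rewrite lerDl.
have := grow (Num.bound M); have := hM _ (Ko (j + Num.bound M)%N).
have := nm_ge0 (o j).
have : M < (Num.bound M)%:R.
  by apply: archi_boundP; apply: le_trans (hM _ (Ko j)); exact: nm_ge0.
lra.
Qed.

(* For r large, these compact sets decrease with n to {(c, z) : |c| <= s, z \in K_c}. *)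
Fixpoint stays (s r : R) (n : nat) : set (C * C) :=
  if n is n'.+1 then
    [set u | [/\ nm u.1 <= s, nm u.2 <= r
               & exists w, corr p q u.1 u.2 w /\ stays s r n' (u.1, w)]]
  else [set u | nm u.1 <= s /\ nm u.2 <= r].

Lemma stays_disc s r n u : stays s r n u -> nm u.1 <= s /\ nm u.2 <= r.
Proof. by case: n => [//|n [? ? _]]. Qed.

Lemma stays_anti s r n m u : (n <= m)%N -> stays s r m u -> stays s r n u.
Proof.
elim: n m u => [|n IH] [|m] u //; first by move=> _ /stays_disc.
by move=> nm [? ? [w [? ?]]]; split=> //; exists w; split=> //; exact: (IH m).
Qed.

Lemma continuousX_at (T : topologicalType) (g : T -> C) k x :
  {for x, continuous g} -> {for x, continuous (fun y => g y ^+ k)}.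
Proof.
move=> gc; elim: k => [|k IH]; first exact: cst_continuous.
have -> : (fun y => g y ^+ k.+1) = (fun y => g y * g y ^+ k).
  by apply/funext => y; rewrite exprS.
exact: (continuousM gc IH).
Qed.

(** Stage n + 1 is the projection to (c, z) of a compact set of triples (c, z, w), the image w being
    a bounded extra coordinate subject to closed conditions. *)
Lemma stays_compact s r n : compact (stays s r n).
Proof.
have cXY : compact ([set z : C | nm z <= s] `*` [set z : C | nm z <= r]).
  by apply: compact_setX; exact: disc_compact.
elim: n => [|n IH].
  by have -> : stays s r 0 = [set z : C | nm z <= s] `*` [set z : C | nm z <= r] by [].
pose T3 : set (C * C * C) := [set t | [/\ nm t.1.1 <= s, nm t.1.2 <= r,
  corr p q t.1.1 t.1.2 t.2 & stays s r n (t.1.1, t.2)]].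
have c1 : continuous (fun t : C * C * C => t.1.1).
  by move=> t; apply: (@continuous_comp _ _ _ fst fst); exact: cvg_fst.
have c2 : continuous (fun t : C * C * C => t.1.2).
  by move=> t; apply: (@continuous_comp _ _ _ fst snd); [exact: cvg_fst|exact: cvg_snd].
have c3 : continuous (fun t : C * C * C => t.2).
  by move=> t; exact: cvg_snd.
have cT3 : compact T3.
  apply: (@subclosed_compact _ _ (([set z : C | nm z <= s] `*` [set z : C | nm z <= r])
    `*` [set z : C | nm z <= r])); last first.
  - by move=> [[c z] w] [/= ? ? ? /stays_disc []].
  - by apply: compact_setX => //; exact: disc_compact.
  have -> : T3 = (fun t : C * C * C => nm t.1.1) @^-1` [set x | x <= s] `&`
     (fun t : C * C * C => nm t.1.2) @^-1` [set x | x <= r] `&`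
     (fun t : C * C * C => (t.2 - t.1.1) ^+ q - t.1.2 ^+ p) @^-1` [set x | x = 0] `&`
     (fun t : C * C * C => (t.1.1, t.2)) @^-1` (stays s r n).
    apply/seteqP; split => [t [/= ? ? ? ?]|t [[[/= ? ?] ?] ?]].
      by split=> //; split => //=; apply/eqP; rewrite subr_eq0; apply/eqP.
    by split=> //; apply/eqP; rewrite -subr_eq0; apply/eqP.
  apply: closedI; first (apply: closedI; first apply: closedI).
  - apply: preimage_closed; last exact: closed_le.
    by move=> t _; apply: (continuous_comp (c1 t)); exact: nm_continuous.
  - apply: preimage_closed; last exact: closed_le.
    by move=> t _; apply: (continuous_comp (c2 t)); exact: nm_continuous.
  - apply: (@preimage_closed _ C _ [set x : C | x = 0]); last first.
      apply: (@compact_closed C); first exact: norm_hausdorff.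
      exact: compact_set1.
    move=> t _.
    have c31 : {for t, continuous (fun t : C * C * C => t.2 - t.1.1)}.
      exact: (cvgB (c3 t) (c1 t)).
    exact: (cvgB (@continuousX_at _ _ q _ c31) (@continuousX_at _ _ p _ (c2 t))).
  - apply: preimage_closed; last first.
      apply: compact_closed IH; exact: norm_hausdorff.
    by move=> t _; exact: (cvg_pair (c1 t) (c3 t)).
have -> : stays s r n.+1 = fst @` T3.
  apply/seteqP; split => [[c z] [/= ? ? [w [? ?]]]|_ [[[c z] w] [/= ? ? ? ?] <-]].
    by exists ((c, z), w).
  by split=> //=; exists w.
have cf : continuous (fst : C * C * C -> C * C) by move=> t; exact: cvg_fst.
exact: continuous_compact (continuous_subspaceT cf) cT3.
Qed.

(** The converse is a König argument: a point has finitely many images, and if each failed at some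
    stage, the largest of these stages would exclude the point itself one stage later. Choosing a
    surviving image again and again builds the orbit. *)
Lemma filled_juliaP (s : R) (c z : C) : nm c <= s ->
  filled_julia p q c z <-> forall n, stays s (escape_radius s) n (c, z).
Proof.
move=> cs; split=> [ [ o bo] n|].
  have od := bounded_orbit_disc cs bo; have [[oz oc] _] := bo.
  rewrite -oz; elim: n 0%N => [|n IH] j; first by split=> /=.
  by split => //=; exists (o j.+1); split=> //; exact: oc.
set P := fun z => forall n, stays s (escape_radius s) n (c, z).
rewrite -/(P z) => Pz.
have next (y : C) : exists w, P y -> corr p q c y w /\ P w.
  apply: contrapT => H.
  have Py : P y by apply: contrapT => nPy; apply: H; exists 0.
  have {}H w : corr p q c y w -> exists n, ~ stays s (escape_radius s) n (c, w).
    move=> cw; apply: contrapT => H'; apply: H; exists w => _; split=> // n.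
    by apply: contrapT => H''; apply: H'; exists n.
  have [t ht] := roots_finite (y ^+ p) q_gt0.
  have [N hN] : exists N, forall w, corr p q c y w -> w - c \in t ->
      ~ stays s (escape_radius s) N (c, w).
    elim: t {ht} => [|x t [N hN]]; first by exists 0%N.
    have [cx|ncx] := pselect (corr p q c y (x + c)).
      have [M hM] := H _ cx; exists (maxn N M) => w cw; rewrite in_cons.
      case/orP=> [/eqP xw|xt].
        move/(stays_anti (leq_maxr N M)); move: hM; rewrite -xw subrK; exact.
      by move/(stays_anti (leq_maxl N M)); apply: hN.
    exists N => w cw; rewrite in_cons => /orP[/eqP xw|]; last exact: hN.
    by case: ncx; rewrite -xw subrK.
  have [_ _ [w [cw sw]]] := Py N.+1.
  by apply: (hN w cw _ sw); exact: ht.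
have [g hg] := choice next.
pose o := fun j => iter j g z.
have Po j : P (o j) by elim: j => [//|j IH]; exact: (hg _ IH).2.
exists o; split; first by split=> // j; exact: (hg _ (Po j)).1.
exists [set z : C | nm z <= escape_radius s]; first exact: disc_compact.
by move=> j; exact: (Po j 0%N).2.
Qed.

(** An excluded point fails at some finite stage, which is an open condition on (c, z) jointly. The
    1 added to [nm c0] lets one escape radius serve all nearby parameters. *)
Lemma filled_julia_usc (c0 z0 : C) : ~ filled_julia p q c0 z0 ->
  \forall u \near (c0, z0), ~ filled_julia p q u.1 u.2.
Proof.
set s := nm c0 + 1.
have cs : nm c0 <= s by rewrite lerDl.
move=> h; have [n hn] : exists n, ~ stays s (escape_radius s) n (c0, z0).
  apply: contrapT => H; apply: h; apply/(filled_juliaP _ cs) => n.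
  by apply: contrapT => H'; apply: H; exists n.
have cl : closed (stays s (escape_radius s) n).
  by apply: compact_closed; [exact: norm_hausdorff|exact: stays_compact].
have nb : \forall u \near (c0, z0), ~ stays s (escape_radius s) n u.
  exact: (open_nbhs_nbhs (conj (closed_openC cl) hn)).
have nc : \forall u \near (c0, z0), nm u.1 < s.
  have : \forall c \near c0, nm c < s by apply: nbhs_nm_lt; rewrite ltrDl.
  exact: (@cvg_fst _ _ (nbhs c0) (nbhs z0)).
near=> u => Ku.
have us : nm u.1 <= s by apply: ltW; near: u.
have : ~ stays s (escape_radius s) n u by near: u.
by apply; rewrite [u]surjective_pairing; exact: (filled_juliaP _ us).1.
Unshelve. all: by end_near. Qed.

Lemma filled_julia_closed (c : C) : closed (filled_julia p q c).
Proof.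
move=> z clz; apply: contrapT => /filled_julia_usc [[A B] [/= nA nB] AB].
have [w [Kw Bw]] := clz _ nB.
by apply: (AB (c, w)) => //=; split=> //=; exact: nbhs_singleton.
Qed.

Lemma filled_julia_compact (c : C) : compact (filled_julia p q c).
Proof.
apply: (@compactP_nm _ _ (escape_radius (nm c))); first exact: filled_julia_closed.
move=> z [ o bo]; have [[oz _] _] := bo.
rewrite -oz; exact: bounded_orbit_disc bo 0%N.
Qed.

End FilledJulia.

(** * Limit models and tangent sets *)

Section LimitModels.
Context {R : realType}.
Notation C := (Cplx R).
Implicit Types (A B K : set C) (x al lam : C).

(* Near x', the affine image x' + al (K - x) is contained in K' to first order. *)
Definition tangent_incl K x K' x' al := forall e : R, 0 < e ->
  \forall w \near x, K w ->
    exists w', K' w' /\ nm (w' - x' - al * (w - x)) <= e * nm (w - x).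

(* Asymptotic self-similarity without the circle: points may leave the disc. *)
Definition rescaled_limit lam K x B := exists2 r : R, 0 < r &
  forall e : R, 0 < e -> \forall k \near \oo,
    (forall w, K w -> nm (lam ^+ k * (w - x)) <= r ->
       exists b, B b /\ nm (b - lam ^+ k * (w - x)) <= e) /\
    (forall b, B b -> nm b <= r ->
       exists w, K w /\ nm (lam ^+ k * (w - x) - b) <= e).

Lemma nm_expr_large lam (r d : R) : 1 < nm lam -> 0 < d ->
  \forall k \near \oo, r < d * nm lam ^+ k.
Proof.
move=> l1 d0; have l0 : 0 < nm lam by apply: lt_trans l1.
have h : `|(nm lam)^-1| < 1 by rewrite gtr0_norm ?invr_gt0// invf_lt1.
have r1 : 0 < d / (`|r| + 1) by rewrite divr_gt0// ltr_wpDl.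
have := cvg_expr h; move/cvgrPdist_lt/(_ _ r1); apply: filterS => k.
rewrite sub0r normrN normrX gtr0_norm ?invr_gt0// exprVn => hk.
have lk : 0 < nm lam ^+ k by rewrite exprn_gt0.
apply: le_lt_trans (ler_norm r) _; apply: (@lt_trans _ _ (`|r| + 1)); first by rewrite ltrDl.
by move: hk; rewrite ltr_pdivlMr ?ltr_wpDl// mulrC ltr_pdivrMr.
Qed.

(** Combined with [nm_expr_large]: a point still visible in the disc of radius [r] after a high
    magnification is as close to the base point as first-order estimates require. *)
Lemma nm_rescaled_small lam k (v : C) (r d : R) : nm (lam ^+ k * v) <= r ->
  r < d * nm lam ^+ k -> nm v < d.
Proof.
rewrite nmM nmX => h1 h2; have := le_lt_trans h1 h2.
rewrite mulrC; have [->|l0] := eqVneq (nm lam ^+ k) 0; first by rewrite !mulr0 ltxx.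
by rewrite ltr_pM2r// lt0r l0 exprn_ge0 ?nm_ge0.
Qed.

Lemma nm_rescale lam k (y' y al : C) (e : R) : nm (y' - al * y) <= e * nm y ->
  nm (lam ^+ k * y' - al * (lam ^+ k * y)) <= e * nm (lam ^+ k * y).
Proof.
move=> h; rewrite mulrCA -mulrBr !nmM mulrCA.
by rewrite ler_wpM2l// nm_ge0.
Qed.

(** Each inclusion serves one half of the limit: a visible point of [K'] is pulled back to [K],
    matched in [B] and multiplied by [al], while a point of [K] matching b is pushed forward to
    [K']. *)
Lemma rescaled_limit_transport lam al K x B K' x' : 1 < nm lam -> al != 0 ->
  tangent_incl K x K' x' al -> tangent_incl K' x' K x al^-1 ->
  rescaled_limit lam K x B -> rescaled_limit lam K' x' [set al * b | b in B].
Proof.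
move=> l1 al0 T T' [r0 r00 L].
have A0 : 0 < nm al by rewrite nm_gt0.
have An0 : nm al != 0 by rewrite gt_eqF.
(* Dividing by [al] sends the disc of radius [r'] into that of radius [r0 / 2]; an error of at most
   m <= r0 / 2 then stays within [r0], where the given limit applies. *)
pose r' := nm al * (r0 / 2).
have r20 : 0 < r0 / 2 by rewrite divr_gt0.
have r'0 : 0 < r' by rewrite mulr_gt0.
exists r' => // e e0.
pose m := Num.min (r0 / 2) (e / 2 / nm al).
have m0 : 0 < m by rewrite lt_min r20 !divr_gt0.
have mr : m <= r0 / 2 by rewrite ge_min lexx.
have me : nm al * m <= e / 2.
  by rewrite mulrC -ler_pdivlMr// ge_min lexx orbT.
have e1 : 0 < m / r' by rewrite divr_gt0.
have e2 : 0 < e / 2 / r0 by rewrite !divr_gt0.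
have /nbhs_nm[d1 d10 h1] := T' _ e1.
have /nbhs_nm[d2 d20 h2] := T _ e2.
near=> k.
have L1 : r' < d1 * nm lam ^+ k by near: k; exact: nm_expr_large.
have L2 : r0 < d2 * nm lam ^+ k by near: k; exact: nm_expr_large.
have [La Lb] : (forall w, K w -> nm (lam ^+ k * (w - x)) <= r0 ->
       exists b, B b /\ nm (b - lam ^+ k * (w - x)) <= m) /\
    (forall b, B b -> nm b <= r0 ->
       exists w, K w /\ nm (lam ^+ k * (w - x) - b) <= m) by near: k; exact: L.
split=> [w' Kw' w'r|_ [b Bb <-] br].
  have [w [Kw ww']] := h1 _ (nm_rescaled_small w'r L1) Kw'.
  have {}ww' := nm_rescale lam k ww'.
  set u := lam ^+ k * (w - x) in ww'; set u' := lam ^+ k * (w' - x') in w'r ww' *.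
  have uu' : nm (u - al^-1 * u') <= m.
    apply: (le_trans ww'); apply: (@le_trans _ _ (m / r' * r')).
      by rewrite ler_wpM2l// ltW.
    by rewrite divfK// gt_eqF.
  have ur : nm u <= r0.
    have := nmD (u - al^-1 * u') (al^-1 * u'); rewrite subrK (nmM al^-1) nmV.
    have : (nm al)^-1 * nm u' <= r0 / 2 by rewrite mulrC ler_pdivrMr// mulrC.
    lra.
  have [b [Bb bu]] := La _ Kw ur; exists (al * b); split; first by exists b.
  have -> : al * b - u' = al * (b - u) + al * (u - al^-1 * u').
    by rewrite -mulrDr subrKA mulrBr mulVKf.
  apply: (le_trans (nmD _ _)); rewrite !nmM.
  have := ler_wpM2l (ltW A0) bu; have := ler_wpM2l (ltW A0) uu'; lra.
have b2 : nm b <= r0 / 2 by move: br; rewrite nmM ler_pM2l.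
have br0 : nm b <= r0 by lra.
have [w [Kw wb]] := Lb _ Bb br0.
set u := lam ^+ k * (w - x) in wb.
have ur : nm u <= r0 by have := nmD (u - b) b; rewrite subrK; lra.
have [w' [Kw' ww']] := h2 _ (nm_rescaled_small ur L2) Kw.
have {}ww' := nm_rescale lam k ww'; rewrite -/u in ww'.
exists w'; split=> //; set u' := lam ^+ k * (w' - x') in ww' *.
have uu' : nm (u' - al * u) <= e / 2.
  apply: (le_trans ww'); apply: (@le_trans _ _ (e / 2 / r0 * r0)).
    by rewrite ler_wpM2l// ltW.
  by rewrite divfK// gt_eqF.
have -> : u' - al * b = (u' - al * u) + al * (u - b).
  by rewrite mulrBr addrA subrK.
apply: (le_trans (nmD _ _)); rewrite nmM.
have := ler_wpM2l (ltW A0) wb; lra.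
Unshelve. all: by end_near. Qed.

(** The first term of the minimum gives |y| <= 2 |y'| / |al|; with it the second, divided by |al|,
    turns an error relative to |y| into one relative to |y'|. *)
Lemma tangent_bound (y y' al : C) (e : R) : al != 0 -> 0 < e ->
  nm (y' - al * y) <= Num.min (nm al / 2) (e * nm al ^+ 2 / 2) * nm y ->
  nm (y - al^-1 * y') <= e * nm y'.
Proof.
move=> al0 e0; set m := Num.min _ _ => h.
have A0 : 0 < nm al by rewrite nm_gt0.
have h1 : nm (y' - al * y) <= nm al / 2 * nm y.
  by apply: (le_trans h); rewrite ler_wpM2r ?nm_ge0// ge_min lexx.
have h2 : nm (y' - al * y) <= e * nm al ^+ 2 / 2 * nm y.
  by apply: (le_trans h); rewrite ler_wpM2r ?nm_ge0// ge_min lexx orbT.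
have h3 : nm al / 2 * nm y <= nm y'.
  have := nmD (al * y - y') y'; rewrite subrK nmM nm_subC.
  by move: h1; rewrite -mulrA mulrCA mulrC; lra.
have -> : y - al^-1 * y' = - (al^-1 * (y' - al * y)).
  by rewrite mulrBr mulKf// opprB.
rewrite nmN nmM nmV mulrC ler_pdivrMr//; apply: (le_trans h2).
have := ler_wpM2l (ltW (mulr_gt0 e0 A0)) h3.
suff -> : e * nm al * (nm al / 2 * nm y) = e * nm al ^+ 2 / 2 * nm y by rewrite [e * nm y' * _]mulrAC.
by ring.
Qed.

Lemma tangent_min_gt0 al (e : R) : al != 0 -> 0 < e ->
  0 < Num.min (nm al / 2) (e * nm al ^+ 2 / 2).
Proof.
move=> al0 e0; have A0 : 0 < nm al by rewrite nm_gt0.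
by rewrite lt_min !divr_gt0// mulr_gt0// exprn_gt0.
Qed.

Lemma tangent_incl_map (T : C -> C) K K' x al : has_deriv T x al ->
  (\forall w \near x, K w -> K' (T w)) -> tangent_incl K x K' (T x) al.
Proof.
move=> /has_deriv_near dT KT e e0; apply: filterS2 KT (dT _ e0) => w KT h Kw.
by exists (T w); split; [exact: KT|].
Qed.

(** Preimages close to [x] suffice in place of a differentiable inverse: the estimate for [T] at
    such a preimage is reversed by [tangent_bound]. *)
Lemma tangent_incl_inv (T : C -> C) K K' x al : al != 0 -> has_deriv T x al ->
  (forall U, nbhs x U -> \forall w' \near T x, K' w' ->
     exists w, [/\ U w, K w & w' = T w]) ->
  tangent_incl K' (T x) K x al^-1.
Proof.
move=> al0 /has_deriv_near dT TK e e0.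
apply: filterS (TK _ (dT _ (tangent_min_gt0 al0 e0))) => w' h Kw'.
have [w [hw Kw ->]] := h Kw'; exists w; split=> //.
exact: tangent_bound.
Qed.

Lemma hausdorff_dist_le A B (e : R) :
  (forall x, A x -> exists y, B y /\ nm (x - y) <= e) ->
  (forall y, B y -> exists x, A x /\ nm (y - x) <= e) ->
  (hausdorff_dist A B <= e%:E)%E.
Proof.
move=> AB BA; rewrite /hausdorff_dist ge_max; apply/andP; split;
  apply: ge_ereal_sup => _ [x hx <-].
  have [y [By xy]] := AB _ hx.
  apply: (@le_trans _ _ (nm (x - y))%:E); last by rewrite lee_fin.
  by apply: ereal_inf_lbound; exists y.
have [y [Ay xy]] := BA _ hx.
apply: (@le_trans _ _ (nm (x - y))%:E); last by rewrite lee_fin.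
by apply: ereal_inf_lbound; exists y.
Qed.

Lemma hausdorff_dist_ge0 A B : A !=set0 -> (0 <= hausdorff_dist A B)%E.
Proof.
move=> [x Ax]; rewrite /hausdorff_dist le_max; apply/orP; left.
apply: (@le_trans _ _ (ereal_inf [set (Normc.normc (x - y))%:E | y in B])).
  by apply: le_ereal_inf_tmp => _ [y _ <-]; rewrite lee_fin; exact: nm_ge0.
by apply: ereal_sup_ubound; exists x.
Qed.

(** If [b] has left the disc, the radial projection of [u] to the circle replaces it, at distance r
    - |u| < |b| - |u| <= e. *)
Lemma truncation_near (r : R) B (u b : C) (e : R) : 0 < r -> nm u <= r ->
  B b -> nm (b - u) <= e -> exists y, truncation r B y /\ nm (u - y) <= e.
Proof.
move=> r0 ur Bb bu; have [br|br] := leP (nm b) r.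
  by exists b; split; [left|rewrite nm_subC].
have bu' : nm b - nm u <= e by apply: le_trans bu; exact: nmB.
(* The origin has no radial projection, but all points of the circle are at the same distance r from
   it. *)
have [u0|u0] := eqVneq u 0.
  exists (r%:C%C); split; first by right; apply: etrans (nm_real _) _; rewrite gtr0_norm.
  by rewrite u0 sub0r nmN nm_real gtr0_norm//; move: bu'; rewrite u0 nm0; lra.
have n0 : 0 < nm u by rewrite nm_gt0.
have rn : 1 <= r / nm u by rewrite ler_pdivlMr// mul1r.
exists ((r / nm u)%:C%C * u); split.
  right; apply: etrans (nmM _ _) _; rewrite nm_real ger0_norm; last by lra.
  by rewrite divfK// gt_eqF.
have -> : u - (r / nm u)%:C%C * u = (1 - r / nm u)%:C%C * u.
  by rewrite rmorphB rmorph1 mulrBl mul1r.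
rewrite nmM nm_real ler0_norm; last by lra.
rewrite opprB mulrBl divfK ?gt_eqF// mul1r; lra.
Qed.

Lemma rescaled_limit_hausdorff lam K x B : rescaled_limit lam K x B ->
  exists2 r : R, 0 < r &
    hausdorff_dist (truncation r [set lam ^+ k * (z - x) | z in K])
                   (truncation r B) @[k --> \oo] --> 0%E.
Proof.
move=> [r r0 L]; exists r => // U [d /= d0 dU].
have e0 : 0 < d / 2 by rewrite divr_gt0.
suff H : \forall k \near \oo, U (hausdorff_dist
    (truncation r [set lam ^+ k * (z - x) | z in K]) (truncation r B)) by exact: H.
apply: filterS (L _ e0) => k [La Lb].
set A := [set _ | _ in K].
have circ E (y : C) : nm y = r -> exists v, truncation r E v /\ nm (y - v) <= d / 2.
  by move=> yr; exists y; split; [right|rewrite subrr nm0 ltW].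
have hle : (hausdorff_dist (truncation r A) (truncation r B) <= (d / 2)%:E)%E.
  apply: hausdorff_dist_le => [_ [[[w Kw <-] wr]|/circ //]|b [[Bb br]|/circ //]].
    by have [b [Bb bw]] := La _ Kw wr; exact: truncation_near bw.
  have [w [Kw bw]] := Lb _ Bb br; apply: truncation_near bw => //.
  by exists w.
(* The distance is an extended real, and a supremum over an empty set would be -oo; the circle makes
   the truncations nonempty. *)
have hge : (0 <= hausdorff_dist (truncation r A) (truncation r B))%E.
  apply: hausdorff_dist_ge0; exists (r%:C%C); right.
  by apply: etrans (nm_real _) _; rewrite gtr0_norm.
move: hle hge; rewrite /A; case: hausdorff_dist => [s|//|//].
rewrite !lee_fin => sd s0; apply: dU => /=.
by rewrite sub0r normrN ger0_norm//; lra.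
Qed.

End LimitModels.

(** * Limit models along an orbit *)

Section Koenigs.
Context {R : realType}.
Notation C := (Cplx R).
Implicit Types (K V D : set C) (x al lam : C).

(* By compactness of K and injectivity of phi, phi w is close to 0 only for w
   close to x; this replaces the openness of phi. *)
Lemma koenigs_preimage_near K V D (phi : C -> C) x : compact K ->
  closure V `<=` D -> D x -> {in D &, injective phi} -> phi x = 0 ->
  (forall y, D y -> {for y, continuous phi}) ->
  forall U, nbhs x U -> \forall u \near (0 : C),
    forall w, closure V w -> K w -> phi w = u -> U w.
Proof.
move=> cK VD Dx phi_inj phix phic U.
rewrite nbhsE => -[W [oW Wx] WU].
pose K1 := (closure V `&` K) `&` ~` W.
have cK1 : compact K1.
  apply: compact_closedI; last exact: open_closedC.
  by rewrite setIC; exact: (compact_closedI cK (@closed_closure _ V)).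
have cP : compact (phi @` K1).
  apply: continuous_compact cK1; apply: continuous_in_subspaceT => y.
  by rewrite inE => -[[/VD/phic]].
have oP := closed_openC (compact_closed (@Cplx_hausdorff R) cP).
have nP : (~` (phi @` K1)) 0.
  move=> [w [[Vw _] nWw] pw]; apply: nWw.
  by rewrite (phi_inj w x) ?inE//; [exact: VD|rewrite pw].
apply: filterS (open_nbhs_nbhs (conj oP nP)) => u nu w Vw Kw pw.
by apply: WU; apply: contrapT => nWw; apply: nu; exists w.
Qed.

Lemma koenigs_limit_model K V D (h phi : C -> C) x lam : compact K ->
  1 < nm lam -> koenigs_map h x lam D phi -> open V -> V x -> closure V `<=` D ->
  h x = x -> {for x, continuous h} -> open_at h x ->
  (\forall w \near x, K w <-> K (h w)) ->
  compact [set phi w | w in closure V `&` K] /\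
  rescaled_limit lam K x [set phi w | w in closure V `&` K].
Proof.
move=> cK l1 [Dx [oD hD phi_inj] phix dphi1 phih] oV Vx VD hx hc ho Kh.
have phid y : D y -> has_deriv phi y (derive1 phi y).
  by move=> /hD; exact: derivable_has_deriv.
have phic y : D y -> {for y, continuous phi}.
  by move=> /phid; exact: has_deriv_continuous.
have dphi : has_deriv phi x 1 by rewrite -dphi1; exact: phid.
set B := [set _ | _ in _].
have near_x := @koenigs_preimage_near K V D phi x cK VD Dx phi_inj phix phic.
have nV : nbhs x V by apply: open_nbhs_nbhs.
have lam0 : lam != 0 by rewrite -nm_gt0; exact: lt_trans l1.
have cB : compact B.
  apply: continuous_compact.
    by apply: continuous_in_subspaceT => y; rewrite inE => -[Vy _]; exact: phic (VD _ Vy).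
  by rewrite setIC; exact: (compact_closedI cK (@closed_closure _ V)).
split=> //.
have up : \forall u \near (0 : C), B u -> B (lam * u).
  have nU : nbhs x [set w | (K w <-> K (h w)) /\ phi (h w) = lam * phi w /\ V (h w)].
    apply: filterI => //; apply: filterI => //.
    by apply: hc; rewrite hx.
  apply: filterS (near_x _ nU) => u hu [w [Vw Kw] pw].
  have [[Khw _] [pw' Vhw]] := hu w Vw Kw pw.
  exists (h w); last by rewrite pw' pw.
  by split; [exact: subset_closure|exact: Khw].
(* Openness of [h] at [x] enters here: a point w near [x] is h w' with w' near [x], and phi w' =
   lam^-1 u. *)
have down : \forall u \near (0 : C), B u -> B (lam^-1 * u).
  have nU : nbhs x (h @` [set w | (K w <-> K (h w)) /\ phi (h w) = lam * phi w /\ V w]).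
    rewrite -[X in nbhs X]hx; apply: ho.
    by apply: filterI => //; apply: filterI.
  apply: filterS (near_x _ nU) => u hu [w [Vw Kw] pw].
  have [w' [[_ Khw] [pw' Vw']] hw'] := hu w Vw Kw pw.
  exists w'; first by split; [exact: subset_closure|apply: Khw; rewrite hw'].
  by rewrite -pw -hw' pw' mulKf.
(* The error is zero: the rescaled points belong to [B] themselves. As |lam| > 1, each intermediate
   multiple of w is no larger than the last one, and dividing b by [lam] only shrinks it, so
   one-step invariance near 0 applies throughout. *)
have LB : rescaled_limit lam B 0 B.
  have [r1 r10 h1] : exists2 e : R, 0 < e & forall y, nm (y - 0) < e -> B y -> B (lam * y).
    exact/nbhs_nm.
  have [r2 r20 h2] : exists2 e : R, 0 < e & forall y, nm (y - 0) < e -> B y -> B (lam^-1 * y).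
    exact/nbhs_nm.
  have m0 : 0 < Num.min r1 r2 by rewrite lt_min r10.
  have mr : Num.min r1 r2 / 2 < Num.min r1 r2 by rewrite ltr_pdivrMr// ltr_pMr// ltr1n.
  have [mr1 mr2] : Num.min r1 r2 / 2 < r1 /\ Num.min r1 r2 / 2 < r2.
    by move: mr; rewrite lt_min => /andP[].
  exists (Num.min r1 r2 / 2); first by rewrite divr_gt0.
  move=> e e0; apply: nearW => k; split.
    move=> w Bw wr; exists (lam ^+ k * (w - 0)); split; last by rewrite subrr nm0 ltW.
    rewrite subr0 in wr *.
    elim: k wr => [|k IH] wr; first by rewrite mul1r.
    have wr' : nm (lam ^+ k * w) <= Num.min r1 r2 / 2.
      apply: le_trans wr; rewrite exprS -mulrA [X in _ <= X]nmM.
      by rewrite ler_peMl ?nm_ge0// ltW.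
    rewrite exprS -mulrA; apply: h1; last exact: IH.
    by rewrite subr0; apply: le_lt_trans mr1.
  move=> b Bb br; exists (lam ^- k * b); split; last first.
    by rewrite subr0 mulVKf ?expf_neq0// subrr nm0 ltW.
  elim: k => [|k IH]; first by rewrite expr0 invr1 mul1r.
  rewrite exprS invfM -mulrA; apply: h2 => //; rewrite subr0.
  apply: le_lt_trans mr2; apply: le_trans br; rewrite nmM ler_piMl ?nm_ge0//.
  rewrite nmV nmX invf_le1; first by rewrite exprn_ege1// ltW.
  by rewrite exprn_gt0//; apply: lt_trans l1.
have one0 : (1 : C) != 0 by exact: oner_neq0.
have T : tangent_incl K x B 0 1.
  rewrite -phix; apply: (tangent_incl_map dphi).
  apply: filterS nV => w Vw Kw; exists w; last by [].
  by split; [exact: subset_closure|].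
have T' : tangent_incl B 0 K x 1.
  rewrite -[X in tangent_incl _ _ _ _ X]invr1 -phix.
  apply: (tangent_incl_inv one0 dphi) => U /near_x; rewrite phix.
  apply: filterS => u hu [w [Vw Kw] pw].
  by exists w; split; [exact: (hu w)|exact: Kw|rewrite pw].
have -> : B = [set 1 * b | b in B].
  by apply/seteqP; split => [b Bb|_ [b Bb <-]]; [exists b => //|]; rewrite mul1r.
by apply: (rescaled_limit_transport l1 one0 T' _ LB); rewrite invr1.
Qed.

Variables (F : nat -> C -> C) (zz : nat -> C) (K : set C).
Hypotheses (zzS : forall j, zz j.+1 = F j.+1 (zz j))
  (F_deriv : forall j, \forall y \near zz j, exists2 d, d != 0 & has_deriv (F j.+1) y d)
  (F_inv : forall j, \forall w \near zz j, K w <-> K (F j.+1 w)).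

(** For m = l and k = n along the perturbed orbit, these are the facts about h_c that the Kœnigs
    argument takes as input. *)
Lemma compose_local (m k : nat) :
  [/\ compose F m k (zz m) = zz (m + k)%N,
      {for zz m, continuous (compose F m k)}, open_at (compose F m k) (zz m)
    & \forall w \near zz m, K w <-> K (compose F m k w)].
Proof.
elim: k => [|k [e c o i]].
  rewrite addn0; split.
  - by [].
  - exact: cvg_id.
  - by move=> U nU; apply: (filterS _ nU) => w Uw; exists w.
  - by apply: (@nearW _ (nbhs (zz m))) => w; split.
have Fc : {for zz (m + k)%N, continuous (F (m + k).+1)}.
  by have [d _ hd] := nbhs_singleton (F_deriv (m + k)); exact: has_deriv_continuous hd.
have Fo := has_deriv_open_at (F_deriv (m + k)).
have -> : compose F m k.+1 = (F (m + k).+1 \o compose F m k).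
  by apply/funext => w; rewrite /= addnS.
rewrite -{1 2}e in Fc Fo.
split.
- by rewrite addnS zzS /comp e.
- exact: (continuous_comp c Fc).
- exact: (open_at_comp o Fo).
- have := F_inv (m + k); rewrite -{1}e => /c.
  by apply: filterS2 i => w i1 i2; rewrite i1.
Qed.

Lemma tangent_orbit j d : d != 0 -> has_deriv (F j.+1) (zz j) d ->
  tangent_incl K (zz j) K (zz j.+1) d /\ tangent_incl K (zz j.+1) K (zz j) d^-1.
Proof.
move=> d0 hd; rewrite zzS; split.
  by apply: (tangent_incl_map hd); apply: filterS (F_inv j) => w [].
apply: (tangent_incl_inv d0 hd) => U nU.
apply: (filterS _ (has_deriv_open_at (F_deriv j) (filterI nU (F_inv j)))) => w' [w [Uw Kw] <-] Kw'; exists w; split=> //.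
exact: Kw.2.
Qed.

Lemma scale_image_compact al (B : set C) : compact B -> compact [set al * b | b in B].
Proof.
move=> cB; apply: continuous_compact cB; apply: continuous_subspaceT.
exact: mulrl_continuous.
Qed.

Lemma scale_imageK al (B : set C) : al != 0 ->
  [set al^-1 * b | b in [set al * b | b in B]] = B.
Proof.
move=> al0; apply/seteqP; split=> [_ [_ [b Bb <-] <-]|b Bb]; first by rewrite mulKf.
by exists (al * b); [exists b|rewrite mulKf].
Qed.

(** In the backward direction the factor is d^-1: as d is nonzero, [B j] is recovered from [B j.+1],
    and the two tangent inclusions exchange their roles. *)
Lemma orbit_limit_models (l : nat) lam (B : nat -> set C) : 1 < nm lam ->
  (forall j, B j.+1 = [set derive1 (F j.+1) (zz j) * b | b in B j]) ->
  compact (B l) -> rescaled_limit lam K (zz l) (B l) ->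
  forall j, compact (B j) /\ rescaled_limit lam K (zz j) (B j).
Proof.
move=> l1 BS cBl Ll.
have step j : exists d, [/\ d != 0, derive1 (F j.+1) (zz j) = d &
    tangent_incl K (zz j) K (zz j.+1) d /\ tangent_incl K (zz j.+1) K (zz j) d^-1].
  have [d d0 hd] := nbhs_singleton (F_deriv j).
  by exists d; split; [|exact: has_derivE|exact: tangent_orbit].
have fwd i : compact (B (l + i)%N) /\ rescaled_limit lam K (zz (l + i)%N) (B (l + i)%N).
  elim: i => [|i [cB L]]; first by rewrite addn0.
  have [d [d0 de [T1 T2]]] := step (l + i)%N.
  rewrite addnS BS de; split; first exact: scale_image_compact.
  exact: rescaled_limit_transport L.
have bwd i : (i <= l)%N -> compact (B (l - i)%N) /\ rescaled_limit lam K (zz (l - i)%N) (B (l - i)%N).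
  elim: i => [|i IH] il; first by rewrite subn0.
  have [cB L] := IH (ltnW il); have [d [d0 de [T1 T2]]] := step (l - i.+1)%N.
  have e : (l - i.+1).+1 = (l - i)%N by rewrite subnSK.
  rewrite e in de T1 T2; have eB := BS (l - i.+1)%N; rewrite e de in eB.
  rewrite -(scale_imageK (B (l - i.+1)%N) d0) -eB; split; first exact: scale_image_compact.
  by apply: rescaled_limit_transport L; rewrite ?invr_eq0 ?invrK.
move=> j; have [lj|/ltnW jl] := leqP l j; first by rewrite -(subnKC lj).
by rewrite -(subKn jl); apply: bwd; rewrite leq_subr.
Qed.

End Koenigs.

(** * Branches of the correspondence *)

Section Branches.
Context {R : realType}.
Notation C := (Cplx R).
Variables (p q : nat).
Hypotheses (q_gt0 : (0 < q)%N) (q_lt_p : (q < p)%N).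

Lemma bounded_orbit_shift (c z : C) o k : bounded_orbit p q c z o ->
  bounded_orbit p q c (o k) (fun j => o (j + k)%N).
Proof.
move=> [[oz oc] [K cK Ko]]; split; last by exists K.
by split=> // j; rewrite addSn; exact: oc.
Qed.

Lemma bounded_orbit_cat (c z w : C) o o' k : bounded_orbit p q c z o ->
  bounded_orbit p q c w o' -> corr p q c (o k) w ->
  bounded_orbit p q c z (fun j => if (j <= k)%N then o j else o' (j - k.+1)%N).
Proof.
move=> [[oz oc] [K cK Ko]] [[oz' oc'] [K' cK' Ko']] kw; split; last first.
  exists (K `|` K'); first exact: compactU.
  by move=> j; case: leqP => _; [left|right].
split=> // j; case: (ltngtP j k) => jk.
- exact: oc.
- have -> : (j.+1 - k.+1 = (j - k.+1).+1)%N by lia.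
  exact: oc'.
- by rewrite jk subnn oz'.
Qed.

Lemma filled_julia_pre (c z w : C) : corr p q c z w ->
  filled_julia p q c w -> filled_julia p q c z.
Proof.
move=> zw [ o [[oz oc] [K cK Ko]]].
exists (fun j => if j is j'.+1 then o j' else z); split.
  by split=> // -[|j]; rewrite ?oz//; exact: oc.
exists (K `|` [set z]); first exact: compactU cK (@compact_set1 _ z).
by case=> [|j]; [right|left].
Qed.

Lemma filled_julia_post (c z : C) : filled_julia p q c z ->
  exists2 w, corr p q c z w & filled_julia p q c w.
Proof.
move=> [ o bo]; have [[oz oc] _] := bo; exists (o 1%N); first by rewrite -oz; exact: oc.
by exists (fun j => o (j + 1)%N); exact: bounded_orbit_shift bo.
Qed.

(** Prefixing [z] by 0 gives the critical orbit. If z_j were 0, the tail from there would be a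
    bounded orbit of 0, hence the critical orbit itself, which would then have period j + 1. A
    second image with a bounded orbit could be spliced into a second bounded orbit of 0. *)
Lemma misiurewicz_orbit (a : C) (z : nat -> C) : misiurewicz p q a ->
  bounded_orbit p q a a z ->
  (forall j, z j != 0) /\
  (forall j w, corr p q a (z j) w -> filled_julia p q a w -> w = z j.+1).
Proof.
move=> [ o [bo o_unique [_ o_aper]]] bz.
pose y j := if j is j'.+1 then z j' else 0.
have [[z0 zc] [K cK Kz]] := bz.
have by0 : bounded_orbit p q a 0 y.
  split.
    split=> // -[|j]; last exact: zc.
    by rewrite /corr /y z0 subrr !expr0n !gtn_eqF ?(ltn_trans q_gt0 q_lt_p).
  exists (K `|` [set 0]); first exact: compactU cK (@compact_set1 _ 0).
  by case=> [|j]; [right|left; exact: Kz].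
have yo := o_unique _ by0; split=> [j|j w zw [ o' bo']].
  apply/eqP => zj; apply: o_aper; exists j.+1; split=> // i _.
  have := bounded_orbit_shift j.+1 by0; rewrite [y j.+1]zj => /o_unique.
  by move=> /(congr1 (fun g => g i)) <-; rewrite -yo.
have := o_unique _ (@bounded_orbit_cat a 0 w y o' j.+1 by0 bo' zw).
rewrite -yo => /(congr1 (fun g => g j.+2)).
by rewrite ltnn subnn /= => <-; have [ [ ] ] := bo'.
Qed.

(* The branch stays away from the critical point and value, so differentiating
   (f - a)^q = z^p determines f'. *)
Definition regular_branch_at (a : C) (f : C -> C) (y : C) : Prop :=
  [/\ y != 0, corr p q a y (f y), derive1 f y != 0, has_deriv f y (derive1 f y)
    & derive1 f y = (p%:R * y ^+ p.-1) / (q%:R * (f y - a) ^+ q.-1)].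

Lemma corr_neq (a y w : C) : y != 0 -> corr p q a y w -> w != a.
Proof.
move=> y0 /esym yw; apply: contra_neq (expf_neq0 p y0) => wa.
by rewrite yw wa subrr expr0n eqn0Ngt q_gt0.
Qed.

Lemma univalent_branch_regular (a x : C) (f : C -> C) :
  univalent_branch_at p q a x f -> x != 0 ->
  \forall y \near x, regular_branch_at a f y.
Proof.
move=> [D [Dx [oD hD _] Dc]] x0.
have nD : nbhs x D by apply: open_nbhs_nbhs.
have n0 : \forall y \near x, y != 0.
  have := @nbhs_disc R x (nm x); rewrite nm_gt0 => /(_ x0).
  apply: filterS => y /= yx; apply/eqP => y0.
  by move: yx; rewrite y0 sub0r nmN ltxx.
(* The relation (f - a)^q = z^p has to hold around [y], not only at [y], before both sides are
   differentiated there. *)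
have nnD := near_join nD.
apply: filterS3 nD n0 nnD => y Dy y0 nDy.
have df : has_deriv f y (derive1 f y) by apply: derivable_has_deriv; exact: hD.
have wa : f y - a != 0 by rewrite subr_eq0; exact: corr_neq (Dc _ Dy).
have dl : has_deriv (fun y => (f y - a) ^+ q) y (q%:R * (f y - a) ^+ q.-1 * derive1 f y).
  have -> : (fun y => (f y - a) ^+ q) = (f - cst a) ^+ q.
    by apply/funext => w; rewrite exprfctE.
  by have := is_deriveX q (is_deriveB df (is_derive_cst a y 1)); rewrite subr0.
have dr : has_deriv (fun y => y ^+ p) y (p%:R * y ^+ p.-1).
  have -> : (fun y : C => y ^+ p) = id ^+ p by apply/funext => w; rewrite exprfctE.
  by have := is_deriveX p (is_derive_id y 1); rewrite [_ *: 1]mulr1.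
have e : q%:R * (f y - a) ^+ q.-1 * derive1 f y = p%:R * y ^+ p.-1.
  apply: has_deriv_unique dl _; apply: has_deriv_ext dr.
  by apply: filterS nDy => w /Dc ->.
have q0 : q%:R * (f y - a) ^+ q.-1 != 0.
  by rewrite mulf_neq0 ?expf_neq0// pnatr_eq0 -lt0n.
have p0 : p%:R * y ^+ p.-1 != 0.
  by rewrite mulf_neq0 ?expf_neq0// pnatr_eq0 -lt0n (ltn_trans q_gt0).
have e' : derive1 f y = (p%:R * y ^+ p.-1) / (q%:R * (f y - a) ^+ q.-1).
  by rewrite -e [_ * derive1 f y]mulrC mulfK.
split=> //; first exact: Dc.
by rewrite e' mulf_neq0// invr_neq0.
Qed.

(** The formula for f' is algebraic in y and f y, so continuity of f is enough. This is what makes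
    lambda(c) continuous at a. *)
Lemma regular_derive1_continuous (a x : C) (f : C -> C) :
  (\forall y \near x, regular_branch_at a f y) -> {for x, continuous (derive1 f)}.
Proof.
move=> H; have [x0 xc _ df ex] := nbhs_singleton H.
have fc := has_deriv_continuous df.
have wa : f x - a != 0 by rewrite subr_eq0; exact: corr_neq xc.
pose g (y : C) : C := (p%:R * y ^+ p.-1) / (q%:R * (f y - a) ^+ q.-1).
have gc : {for x, continuous g}.
  have c1 : {for x, continuous (fun y : C => p%:R * y ^+ p.-1)}.
    apply: (@continuousM _ _ (cst p%:R) (fun y : C => y ^+ p.-1)); first exact: cst_continuous.
    by apply: continuousX_at; exact: cvg_id.
  have c2 : {for x, continuous (fun y : C => q%:R * (f y - a) ^+ q.-1)}.
    apply: (@continuousM _ _ (cst q%:R) (fun y : C => (f y - a) ^+ q.-1)); first exact: cst_continuous.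
    by apply: continuousX_at; exact: continuous_subr.
  apply: (continuousM c1); apply: (continuousV _ c2).
  by rewrite mulf_neq0 ?expf_neq0// pnatr_eq0 -lt0n.
move=> U; rewrite ex => /gc; apply: filterS2 H => y [_ _ _ _ ey].
by rewrite /= ey.
Qed.

Lemma branch_julia_invariant (a x : C) (f : C -> C) :
  (\forall y \near x, regular_branch_at a f y) ->
  (forall w, corr p q a x w -> filled_julia p q a w -> w = f x) ->
  \forall u \near (a, x),
    filled_julia p q u.1 u.2 <-> filled_julia p q u.1 (f u.2 + (u.1 - a)).
Proof.
move=> H uniq; have [x0 xc _ df _] := nbhs_singleton H.
have wa : f x - a != 0 by rewrite subr_eq0; exact: corr_neq xc.
have fc := has_deriv_continuous df.
have [s hs] := roots_finite (1 : C) q_gt0.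
(* Each root of unity other than 1 is excluded on its own neighbourhood, and there are finitely
   many. The list [s] may contain other numbers, hence the test on t ^+ q. *)
have bad : \forall u \near (a, x), forall t : C, t \in s -> t ^+ q = 1 -> t != 1 ->
    ~ filled_julia p q u.1 (u.1 + t * (f u.2 - a)).
  elim: s {hs} => [|t s IH]; first by apply: (@nearW _ (nbhs ((a, x) : C * C))) => u t; rewrite in_nil.
  have ht : \forall u \near (a, x), t ^+ q = 1 -> t != 1 ->
      ~ filled_julia p q u.1 (u.1 + t * (f u.2 - a)).
    have [tq|] := pselect (t ^+ q = 1 /\ t != 1); last first.
      by move=> nt; apply: (@nearW _ (nbhs ((a, x) : C * C))) => u tq t1; case: nt.
    have [tq1 t1] := tq.
    have nK : ~ filled_julia p q a (a + t * (f x - a)).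
      have cw : corr p q a x (a + t * (f x - a)).
        by rewrite /corr addrC addKr exprMn tq1 mul1r.
      move=> /(uniq _ cw) e; move/eqP: t1; apply.
      apply: (mulIf wa); rewrite mul1r; apply: (addrI a); rewrite e.
      by rewrite addrC subrK.
    have cont : {for (a, x), continuous (fun u : C * C => (u.1, u.1 + t * (f u.2 - a)))}.
      have c1 : {for (a, x), continuous (fst : C * C -> C)} by exact: cvg_fst.
      have c2 : {for (a, x), continuous (snd : C * C -> C)} by exact: cvg_snd.
      have g1 : {for x, continuous (fun y => f y - a)} by exact: continuous_subr.
      have g2 : {for f x - a, continuous (fun w => t * w)} by exact: mulrl_continuous.
      have c3 : {for (a, x), continuous (fun u : C * C => t * (f u.2 - a))}.
        exact: (continuous_comp c2 (continuous_comp g1 g2)).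
      exact: (cvg_pair c1 (cvgD c1 c3)).
    have := filled_julia_usc q_gt0 q_lt_p nK.
    by move=> /cont hn; apply: (@filterS _ (nbhs ((a, x) : C * C)) _ _ _ _ hn) => u hu _ _; exact: hu.
  apply: filterS2 ht IH => u h1 h2 t'; rewrite in_cons => /orP[/eqP ->//|].
  exact: h2.
have Hu : \forall u \near (a, x), regular_branch_at a f u.2.
  exact: (@cvg_snd _ _ (nbhs a) (nbhs x)).
apply: filterS2 bad Hu => -[c y] /= hbad [y0 yc _ _ _].
have ya : f y - a != 0 by rewrite subr_eq0; exact: corr_neq yc.
split=> [/filled_julia_post [w cw Kw]|]; last first.
  by apply: filled_julia_pre; rewrite /corr addrCA (addrC c) addrK.
(* Both w - c and f y - a have q-th power y^p, so their quotient is a q-th root of unity. *)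
pose t := (w - c) / (f y - a).
have tq : t ^+ q = 1 by rewrite expr_div_n cw yc divff// expf_neq0.
have wt : w = c + t * (f y - a) by rewrite divfK// addrC subrK.
have [t1|t1] := eqVneq t 1.
  by move: Kw; rewrite wt t1 mul1r addrCA.
by case: (hbad t (hs _ tq) tq t1); rewrite -wt.
Qed.

End Branches.

(** * The perturbed orbit *)

Section PerturbedOrbit.
Context {R : realType}.
Notation C := (Cplx R).
Variables (p q : nat).
Hypotheses (q_gt0 : (0 < q)%N) (q_lt_p : (q < p)%N).

Lemma has_deriv_addc (f : C -> C) (x d k : C) : has_deriv f x d ->
  has_deriv (fun y => f y + k) x d.
Proof.
move=> /has_deriv_near h; apply/has_deriv_near => e e0.
apply: filterS (h _ e0) => y; congr (nm (_ - _) <= _).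
by rewrite opprD addrACA subrr addr0.
Qed.

Lemma near_continuous_near (T U : topologicalType) (u : T -> U) (a : T) (P : U -> Prop) :
  {for a, continuous u} -> (\forall y \near u a, P y) ->
  \forall c \near a, \forall y \near u c, P y.
Proof. by move=> uc /near_join; exact: uc. Qed.

Lemma near_pair_near (T U : topologicalType) (u : T -> U) (a : T) (P : T * U -> Prop) :
  {for a, continuous u} -> (\forall t \near (a, u a), P t) ->
  \forall c \near a, \forall y \near u c, P (c, y).
Proof.
move=> uc [[A B] [/= nA nB] AB]; have := near_continuous_near uc nB.
apply: filterS2 nA => c Ac; apply: filterS => y By; exact: (AB (c, y)).
Qed.

Lemma compose_add (F : nat -> C -> C) (m k : nat) x :
  compose F 0 (m + k) x = compose F m k (compose F 0 m x).
Proof. by elim: k => [|k IH]; rewrite ?addn0// addnS /= -IH add0n addnS. Qed.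

Lemma perturbed_orbitS (a : C) f xi c j : perturbed_orbit a f xi c j.+1 =
  perturbed a f c j.+1 (perturbed_orbit a f xi c j).
Proof. by []. Qed.

Lemma perturbed_orbit_cvg (a : C) (f : nat -> C -> C) (xi : C -> C)
    (z : nat -> C) : xi a = z 0%N -> {for a, continuous xi} ->
  (forall j, f j.+1 (z j) = z j.+1 /\ {for z j, continuous (f j.+1)}) ->
  forall j, perturbed_orbit a f xi a j = z j /\
    {for a, continuous (fun c => perturbed_orbit a f xi c j)}.
Proof.
move=> xia xic fz; elim=> [//|j [e cj]]; have [fe fc] := fz j.
split.
  by rewrite perturbed_orbitS e /perturbed subrr addr0.
rewrite -e in fc.
have c1 := continuous_comp cj fc.
have c2 : {for a, continuous (fun c : C => c - a)}.
  by apply: continuous_subr; exact: cvg_id.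
exact: (cvgD c1 c2).
Qed.

Lemma compose_deriv (F : nat -> C -> C) (zz d : nat -> C) m :
  (forall j, zz j.+1 = F j.+1 (zz j)) -> forall k,
  (forall i, (i < k)%N -> has_deriv (F (m + i).+1) (zz (m + i)%N) (d (m + i)%N)) ->
  compose F m k (zz m) = zz (m + k)%N /\
  has_deriv (compose F m k) (zz m) (\prod_(i < k) d (m + i)%N).
Proof.
move=> zzS; elim=> [_|k IH dF].
  by rewrite addn0 big_ord0; split=> //; exact: is_derive_id.
have [e dk] : compose F m k (zz m) = zz (m + k)%N /\
    has_deriv (compose F m k) (zz m) (\prod_(i < k) d (m + i)%N).
  by apply: IH => i ik; apply: dF; exact: ltnW.
have -> : compose F m k.+1 = (fun w => F (m + k).+1 (compose F m k w)).
  by apply/funext => w; rewrite /= addnS.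
rewrite addnS zzS e big_ord_recr /= mulrC; split; first by [].
by apply: (has_deriv_comp dk); rewrite e; exact: dF.
Qed.

Lemma prod_continuous (k : nat) (g : nat -> C -> C) (a : C) :
  (forall i, {for a, continuous (g i)}) ->
  {for a, continuous (fun c => \prod_(i < k) g i c)}.
Proof.
move=> gc; elim: k => [|k IH].
  have -> : (fun c => \prod_(i < 0) g i c) = cst 1.
    by apply/funext => c; rewrite big_ord0.
  exact: cst_continuous.
have -> : (fun c => \prod_(i < k.+1) g i c) = (fun c => (\prod_(i < k) g i c) * g k c).
  by apply/funext => c; rewrite big_ord_recr.
exact: (continuousM IH (gc k)).
Qed.

Lemma near_forall_ord (k : nat) (a : C) (P : nat -> set C) :
  (forall j, \forall c \near a, P j c) ->
  \forall c \near a, forall j, (j < k)%N -> P j c.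
Proof.
move=> H; elim: k => [|k IH].
  by apply: (@nearW _ (nbhs a)).
apply: (@filterS2 _ (nbhs a) _ _ _ _ _ IH (H k)) => c h1 h2 j.
by rewrite ltnS leq_eqVlt => /orP[/eqP ->|/h1].
Qed.

(** Only the germ of the step at [x] is involved, so the property passes unchanged from an index to
    the one a period later. *)
Definition regular_step (F : nat -> C -> C) c j (x : C) : Prop :=
  [/\ corr p q c x (F j.+1 x),
      \forall y \near x, exists2 d, d != 0 & has_deriv (F j.+1) y d
    & \forall w \near x, filled_julia p q c w <-> filled_julia p q c (F j.+1 w)].

Lemma regular_step_near (a : C) (f : nat -> C -> C) j x (u : C -> C) :
  u a = x -> {for a, continuous u} ->
  (\forall y \near x, regular_branch_at p q a (f j.+1) y) ->
  (forall w, corr p q a x w -> filled_julia p q a w -> w = f j.+1 x) ->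
  \forall c \near a, regular_step (perturbed a f c) c j (u c).
Proof.
move=> <- uc H uniq.
have H1 := near_continuous_near uc H.
have H2 := near_pair_near uc (branch_julia_invariant q_gt0 q_lt_p H uniq).
apply: (@filterS2 _ (nbhs a) _ _ _ _ _ H1 H2) => c Hc Kc.
have [_ cx _ _ _] := nbhs_singleton Hc; split.
- by rewrite /corr /perturbed addrCA (addrC c) addrK.
- apply: filterS Hc => y [_ _ d0 dy _].
  exists (derive1 (f j.+1) y); first exact: d0.
  exact: (has_deriv_addc (c - a) dy).
- exact: Kc.
Qed.

(** All values occur among the first l + n terms, so the sum of the moduli of these terms bounds the
    whole orbit. *)
Lemma cyclic_orbit_julia (c : C) (zz : nat -> C) l n : (0 < n)%N ->
  (forall j, corr p q c (zz j) (zz j.+1)) ->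
  (forall j, (l <= j)%N -> zz (j + n)%N = zz j) ->
  forall j, filled_julia p q c (zz j).
Proof.
clear q_gt0 q_lt_p; move=> n0 zc zn j.
have bz i : nm (zz i) <= \sum_(k < l + n) nm (zz k).
  elim/ltn_ind: i => i IH; have [il|li] := ltnP i (l + n).
    by rewrite (bigD1 (Ordinal il))//= lerDl sumr_ge0// => k _; exact: nm_ge0.
  have -> : zz i = zz (i - n)%N by rewrite -[in RHS]zn ?subnK//; lia.
  by apply: IH; lia.
exists (fun i => zz (i + j)%N); split; first by split=> // i; rewrite addSn.
exists [set w : C | nm w <= \sum_(k < l + n) nm (zz k)]; first exact: disc_compact.
by move=> i; exact: bz.
Qed.

Lemma rescaled_limit_self_similar (K : set C) lam x B : closed K -> K x ->
  1 < nm lam -> compact B -> rescaled_limit lam K x B ->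
  self_similar lam K x B.
Proof.
move=> cK Kx l1 cB L; split.
- by rewrite normC_nm ltcR.
- by [].
- split; first exact: (compact_closed (@Cplx_hausdorff R) cB).
  (* Nonemptiness: the base point rescales to 0, which lies in the disc, so at tolerance 1 some
     point of [B] must match it. *)
  have [r r0 /(_ 1 ltr01)] := L; case=> N _ /(_ N (leqnn N)) [/(_ x Kx)].
  by rewrite subrr mulr0 nm0 => /(_ (ltW r0)) [b [Bb _]]; exists b.
- exact: rescaled_limit_hausdorff.
Qed.

End PerturbedOrbit.

Theorem theorem4p1 (R : realType) (p q : nat) (a : Cplx R)
    (z : nat -> Cplx R) (l n : nat) (f : nat -> Cplx R -> Cplx R)
    (zl xi : Cplx R -> Cplx R) :
  (0 < q)%N -> (q < p)%N ->
  misiurewicz p q a ->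
  bounded_orbit p q a a z ->
  enters_cycle z l n ->
  orbit_branches p q a z l n f ->
  1 < `|derive1 (hmap a f l n a) (z l)| ->
  cycle_continuation a f z l n zl ->
  value_continuation a f l zl xi ->
  \forall c \near a,
    forall (D : set (Cplx R)) (phi : Cplx R -> Cplx R),
      koenigs_map (hmap a f l n c) (zl c) (multiplier a f l n zl c) D phi ->
    forall V : set (Cplx R),
      open V -> V (zl c) -> closure V `<=` D ->
    forall B : nat -> set (Cplx R),
      limit_models a f l xi c
        [set phi w | w in closure V `&` filled_julia p q c] B ->
    forall j,
      compact (B j) /\
      self_similar (multiplier a f l n zl c) (filled_julia p q c)
        (perturbed_orbit a f xi c j) (B j).
Proof.
move=> q_gt0 q_lt_p mis bz [[n0 zn] _ _] [fb fn] lam1 [zlh zla hz] [xih xia gx].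
have [z_neq0 z_uniq] := misiurewicz_orbit q_gt0 q_lt_p mis bz.
have z0 : z 0%N = a by have [[]] := bz.
have freg j : \forall y \near z j, regular_branch_at p q a (f j.+1) y.
  have [fbj _] := fb j.+1 isT.
  exact: (univalent_branch_regular q_gt0 q_lt_p fbj (z_neq0 j)).
have fz j : f j.+1 (z j) = z j.+1 by have [] := fb j.+1 isT.
have fcont j : {for z j, continuous (f j.+1)}.
  by have [_ _ _ df _] := nbhs_singleton (freg j); exact: has_deriv_continuous df.
have xic : {for a, continuous xi}.
  have := derivable_has_deriv (nbhs_singleton xih).
  exact: has_deriv_continuous.
have orb := @perturbed_orbit_cvg R a f xi z (etrans xia (esym z0)) xic
  (fun j => conj (fz j) (fcont j)).
have steps j : \forall c \near a,
    regular_step p q (perturbed a f c) c j (perturbed_orbit a f xi c j).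
  have [e cj] := orb j.
  apply: (@regular_step_near _ _ _ q_gt0 q_lt_p a f j (z j)
    (fun c => perturbed_orbit a f xi c j) e cj (freg j)) => w.
  by rewrite fz; exact: z_uniq.
(* The chain rule factors of h_c' along the cycle; adding the constant c - a to a branch leaves its
   derivative unchanged. *)
pose g (i : nat) (c : Cplx R) : Cplx R := derive1 (f (l + i).+1) (perturbed_orbit a f xi c (l + i)).
have gc i : {for a, continuous (g i)}.
  have [e cj] := orb (l + i)%N; apply: (continuous_comp cj); rewrite e.
  exact: (regular_derive1_continuous q_gt0 (freg (l + i)%N)).
have freg_near j : \forall c \near a,
    has_deriv (f j.+1) (perturbed_orbit a f xi c j)
      (derive1 (f j.+1) (perturbed_orbit a f xi c j)).
  have [e cj] := orb j; have := freg j; rewrite -e => /cj.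
  by apply: (@filterS _ (nbhs a)) => c [].
have mult_near : \forall c \near a, perturbed_orbit a f xi c l = zl c ->
    multiplier a f l n zl c = \prod_(i < n) g i c.
  have := @near_forall_ord R (l + n) a _ freg_near.
  apply: (@filterS _ (nbhs a)) => c Hc e.
  rewrite /multiplier -e.
  have [||_ dh] := @compose_deriv R (perturbed a f c) (perturbed_orbit a f xi c)
    (fun j => derive1 (f j.+1) (perturbed_orbit a f xi c j)) l _ n.
  - by move=> j; rewrite perturbed_orbitS.
  - by move=> i ik; apply: has_deriv_addc; apply: Hc; rewrite ltn_add2l.
  exact: has_derivE dh.
have ola : perturbed_orbit a f xi a l = zl a by exact: (nbhs_singleton gx).
(* At [a] the product is the multiplier, of modulus greater than 1 by hypothesis; continuity of the
   product carries this to nearby c. *)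
have lam_near : \forall c \near a, 1 < nm (\prod_(i < n) g i c).
  have c1 := @prod_continuous R n g a gc.
  have c2 := continuous_comp c1 (@nm_continuous R _).
  have : 1 < nm (\prod_(i < n) g i a).
    rewrite -(nbhs_singleton mult_near ola) /multiplier zla.
    by move: lam1; rewrite normC_nm ltcR.
  move=> gt1; have op : open_nbhs (nm (\prod_(i < n) g i a)) [set t : R | 1 < t].
    by split; [exact: open_gt|].
  exact: (c2 _ (open_nbhs_nbhs op)).
(* The first l + n indices cover the preperiod and one full period, so finitely many neighbourhoods
   are intersected. *)
have steps_near := @near_forall_ord R (l + n) a _ steps.
have FN : Filter (nbhs a) by exact: nbhs_filter.
have near_c := @filterI _ _ FN _ _ (@filterI _ _ FN _ _ hz gx)
  (@filterI _ _ FN _ _ mult_near lam_near).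
apply: (filterS2 FN _ steps_near near_c) => c st [[hzc gxc] [mlt lamc]].
set F := perturbed a f c in st hzc *; set zz := perturbed_orbit a f xi c in st mlt *.
have zzl : zz l = zl c by exact: gxc.
have {mlt} lamE := mlt zzl.
have zzS j : zz j.+1 = F j.+1 (zz j) by exact: perturbed_orbitS.
have Fn j : (l < j)%N -> F (j + n)%N = F j.
  by move=> lj; rewrite /F /perturbed fn.
have zzn j : (l <= j)%N -> zz (j + n)%N = zz j.
  move=> lj; rewrite -(subnKC lj); elim: (j - l)%N => [|i IH].
    rewrite addn0; have -> : zz (l + n)%N = compose F l n (zz l) by exact: compose_add.
    by rewrite zzl; exact: hzc.
  by rewrite !addnS addSn !zzS IH -addSn Fn// ltnS leq_addr.
(* For j >= l + n, the index j - n is still at least l, so the point z_j(c) and the branch leaving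
   it are those of j - n, and strong induction applies. *)
have {st} st j : regular_step p q F c j (zz j).
  elim/ltn_ind: j => j IH; have [/st//|lj] := ltnP j (l + n).
  have nj : (n <= j)%N by apply: leq_trans lj; rewrite leq_addl.
  have lj' : (l <= j - n)%N by rewrite leq_subRL// addnC.
  have := IH (j - n)%N; rewrite ltn_subrL n0 (leq_trans n0 nj) => /(_ isT).
  rewrite -(zzn _ lj') subnK// /regular_step -(Fn (j - n).+1) ?ltnS//.
  by rewrite addSn subnK.
have zc j : corr p q c (zz j) (zz j.+1) by rewrite zzS; have [] := st j.
have Kzz := cyclic_orbit_julia n0 zc zzn.
have Fd j : \forall y \near zz j, exists2 d, d != 0 & has_deriv (F j.+1) y d.
  by have [] := st j.
have FK j : \forall w \near zz j, filled_julia p q c w <-> filled_julia p q c (F j.+1 w).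
  by have [] := st j.
have cK := @filled_julia_compact R p q q_gt0 q_lt_p c.
have kK := @filled_julia_closed R p q q_gt0 q_lt_p c.
rewrite lamE => D phi kphi V oV Vx VD B [Bl BS].
have [hx hc ho hK] := compose_local zzS Fd FK l n.
rewrite zzl in hx hc ho hK.
have [cBl Ll] := koenigs_limit_model cK lamc kphi oV Vx VD hzc hc ho hK.
rewrite -Bl -zzl in cBl Ll.
move=> j; have [cB L] := orbit_limit_models zzS Fd FK lamc (fun j => BS j.+1 isT) cBl Ll j.
by split=> //; exact: rescaled_limit_self_similar.
Qed.
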